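(* Consider the $d$-dimensional Lorenz '96 system described in the context, with the first three coordinates observed. For $j\ge d-3$, for Lebesgue almost every initial point $u\in\mathcal B_R$, the following holds: $\|u\|<R$; the system of equations in $v$ given by $HD^iu=HD^iv$ for every $0\le i\le j$ has the unique solution $v=u$ in $\mathcal B_R$; and $$\mathrm{span}\left\{\nabla\big((HD^iu)_l\big):0\le i\le j,\ 1\le l\le d_o\right\}=\mathbb R^d .$$ As a consequence, for $\epsilon$-bounded observation errors ($\|Z_i\|\le\epsilon$ almost surely for every $i\in\mathbb N$), for almost every initial point $u\in\mathcal B_R$, for sufficiently small $h$, the diameters of the supports of the smoother $\mu^{\mathrm{sm}}(\cdot|Y_0,\ldots,Y_k)$ and the filter $\mu^{\mathrm{fi}}(\cdot|Y_0,\ldots,Y_k)$ can be bounded by $C_{\mathrm{sm}}(u,k)\epsilon$ and $C_{\mathrm{fi}}(u,k)\epsilon$, respectively, for some finite constants $C_{\mathrm{sm}}(u,k)$ and $C_{\mathrm{fi}}(u,k)$ which do not depend on $\epsilon$. Moreover, for unbounded observation errors satisfying $\sigma_Z^2:=\mathbb E(\|Z_i\|^2)<\infty$, for almost every initial point $u\in\mathcal B_R$, for sufficiently small $h$, there are some estimators based on the observations, $U_{\mathrm{sm}}(Y_0,\ldots,Y_k)$ and $U_{\mathrm{fi}}(Y_0,\ldots,Y_k)$, such that the mean square errors $\mathbb E\left[\|U_{\mathrm{sm}}(Y_0,\ldots,Y_k)-u\|^2\right]$ and $\mathbb E\left[\|U_{\mathrm{fi}}(Y_0,\ldots,Y_k)-u(t_k)\|^2\right]$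 of the initial and current positions are bounded by $D_{\mathrm{sm}}(u,k)\sigma_Z^2$ and $D_{\mathrm{fi}}(u,k)\sigma_Z^2$, respectively, for some finite constants $D_{\mathrm{sm}}(u,k)$ and $D_{\mathrm{fi}}(u,k)$ which do not depend on $\sigma_Z$.
   Context: System: $\frac{du}{dt}=-Au-B(u,u)+f$ on $\mathbb R^d$ with $A=I_{d\times d}$, $f=(8,\ldots,8)^T$, and the $i$th coordinate of $B(u,\tilde u)$ equal to $$-\tfrac12\left(\tilde u_{i-1}u_{i+1}+u_{i-1}\tilde u_{i+1}-\tilde u_{i-2}u_{i-1}-u_{i-2}\tilde u_{i-1}\right),$$ indices understood modulo $d$. For $v\in\mathbb R^d$, $v(t)=\Psi_t(v)$ is the solution with $v(0)=v$, and $D^iv:=\frac{d^iv(t)}{dt^i}\big|_{t=0}$ (so $D^0v=v$). $R>0$ is such that, for some $\delta>0$, $\langle-Av-B(v,v)+f,v\rangle\le0$ whenever $\|v\|\in[R,R+\delta]$ (such $R$ exist); $\mathcal B_R=\{v:\|v\|\le R\}$, which is forward invariant; $\Psi_t$ is one-to-one from $\mathcal B_R$ onto $\Psi_t(\mathcal B_R)$ with inverse $\Psi_{-t}$. $\nabla$ denotes the gradient as a function of $u$, $(\cdot)_l$ the $l$th coordinate. Observations: $H\in\mathbb R^{d_o\times d}$ is the matrix with $H_{1,1}=H_{2,2}=H_{3,3}=1$ and all other entries $0$; $t_i=ih$ with $h>0$, $Y_i=Hu(t_i)+Z_i$, $Z_i$ i.i.d. centered with density $\eta$, true initial point $u$;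 $Y_0,\ldots,Y_k$ are the observations up to time $t_k$, $k\in\mathbb N$; expectations are over the noise for fixed $u$. The prior $q$ is a probability density vanishing outside $\mathcal B_R$. Smoothing density: $\mu^{\mathrm{sm}}(v|Y_0,\ldots,Y_k)\propto q(v)\prod_{i=0}^k\eta(Y_i-H\Psi_{t_i}(v))$ for $v\in\mathcal B_R$, $0$ otherwise. Filtering density: $\mu^{\mathrm{fi}}(v|Y_0,\ldots,Y_k)\propto\left[\prod_{i=0}^k\eta(Y_i-H\Psi_{t_i-t_k}(v))\right]\det(J\Psi_{-t_k}(v))\,q(\Psi_{-t_k}(v))$ for $v\in\Psi_{t_k}(\mathcal B_R)$ ($J$ the Jacobian, $\Psi_{t_i-t_k}(v)=\Psi_{t_i}(\Psi_{-t_k}(v))$), $0$ otherwise. Support means the set where the density is nonzero.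
   Formalization: The smoother/filter and estimator bounds are proved for k ≥ j (so for all k ≥ d−3), since for d ≥ 4 and k = 0 they fail; for ε-bounded errors the density η is taken to vanish outside the ball of radius ε. *)

(* Defs.v *)
From HB Require Import structures.
From mathcomp Require Import all_boot all_order all_algebra.
From mathcomp Require Import all_classical all_reals all_analysis.
Set Implicit Arguments.
Unset Strict Implicit.
Unset Printing Implicit Defensive.
Import Order.TTheory GRing.Theory Num.Theory numFieldNormedType.Exports.
Local Open Scope classical_set_scope.
Local Open Scope ring_scope.

(* Row vectors carry the product sigma-algebra, generated by the coordinates;
   over R it is the Borel sigma-algebra. *)
Section rV_measurable.
Context {d} {T : measurableType d}.
Variable n : nat.

Let coors (i : 'I_n) (x : 'rV[T]_n) : T := x ord0 i.

Let rV_set0 : g_sigma_preimage coors set0.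
Proof. exact: sigma_algebra0. Qed.

Let rV_setC A : g_sigma_preimage coors A -> g_sigma_preimage coors (~` A).
Proof. exact: sigma_algebraC. Qed.

Let rV_bigcup (F : (set 'rV[T]_n)^nat) :
  (forall i, g_sigma_preimage coors (F i)) ->
  g_sigma_preimage coors (\bigcup_i (F i)).
Proof. exact: sigma_algebra_bigcup. Qed.

HB.instance Definition _ := @isMeasurable.Build (measure_tuple_display d)
  'rV[T]_n (g_sigma_preimage coors) rV_set0 rV_setC rV_bigcup.
End rV_measurable.

Section rV_measurable_lemmas.
Context {d} {T : measurableType d}.

Lemma measurable_coord n (i : 'I_n) :
  measurable_fun [set: 'rV[T]_n] (fun x : 'rV[T]_n => x ord0 i).
Proof.
move=> _ Y mY; rewrite setTI; apply: sub_sigma_algebra => /=.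
rewrite -bigcup_seq/=; exists i => /=; first by rewrite mem_index_enum.
by exists Y => //; rewrite setTI.
Qed.

Lemma measurable_fun_coord d1 (T1 : measurableType d1) n (f : T1 -> 'rV[T]_n) :
  (forall i, measurable_fun setT (fun x => f x ord0 i)) ->
  measurable_fun [set: T1] f.
Proof.
move=> mf _ A mA; rewrite setTI.
pose S := [set B : set 'rV[T]_n | measurable (f @^-1` B)].
have sS : sigma_algebra setT S.
  split=> [|B SB|F SF]; rewrite /S /=.
  - by rewrite preimage_set0.
  - by rewrite setTD preimage_setC; exact: measurableC.
  - by rewrite preimage_bigcup; exact: bigcupT_measurable.
apply: (mA S); split => // B.
rewrite -bigcup_seq/= => -[i _ [C mC <-]].
by rewrite setTI /S /= -comp_preimage -[X in measurable X]setTI; exact: mf.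
Qed.

End rV_measurable_lemmas.

Section lebesgue_rV.
Context {R : realType}.

Definition rV_cons n (p : measurableTypeR R * 'rV[R]_n) : 'rV[R]_n.+1 :=
  row_mx (p.1)%:M p.2 : 'rV[R]_(1 + n).

Let rV_cons0 n (p : measurableTypeR R * 'rV[R]_n) : rV_cons p ord0 ord0 = p.1.
Proof.
have -> : ord0 = lshift n (ord0 : 'I_1) :> 'I_(1 + n) by exact/val_inj.
by apply: (etrans (row_mxEl _ _ _ _)); rewrite mxE eqxx.
Qed.

Let rV_consS n (p : measurableTypeR R * 'rV[R]_n) i :
  rV_cons p ord0 (lift ord0 i) = p.2 ord0 i.
Proof.
have -> : lift ord0 i = rshift 1 i :> 'I_(1 + n) by exact/val_inj.
exact: row_mxEr.
Qed.

Let measurable_rV_cons n :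
  measurable_fun setT (@rV_cons n : measurableTypeR R * 'rV[R]_n -> 'rV[R]_n.+1).
Proof.
apply: measurable_fun_coord => i; have [j ->|->] := unliftP ord0 i.
  under eq_fun do rewrite rV_consS.
  exact: (measurableT_comp (measurable_coord j) measurable_snd).
under eq_fun do rewrite rV_cons0.
exact: measurable_fst.
Qed.

Section lebesgue_rVS.
Local Open Scope ereal_scope.
Context n (mu : {sigma_finite_measure set 'rV[R]_n -> \bar R}).

Let nu : {measure set (measurableTypeR R * 'rV[R]_n)%type -> \bar R} :=
  @lebesgue_measure R \x mu.

Definition lebesgue_rVS : set 'rV[R]_n.+1 -> \bar R :=
  pushforward (@lebesgue_measure R \x mu) (@rV_cons n).

Let measurable_cons_preimage A :
  measurable A -> measurable (@rV_cons n @^-1` A).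
Proof. by move=> mA; rewrite -[X in measurable X]setTI; exact: measurable_rV_cons. Qed.

Let lebesgue_rVS0 : lebesgue_rVS set0 = 0.
Proof. by exact: (measure0 nu). Qed.

Let lebesgue_rVS_ge0 A : 0 <= lebesgue_rVS A.
Proof. exact: (measure_ge0 nu). Qed.

Let lebesgue_rVS_sigma_additive : semi_sigma_additive lebesgue_rVS.
Proof.
move=> F mF tF mUF; rewrite /lebesgue_rVS /pushforward preimage_bigcup.
apply: (measure_semi_sigma_additive (s := nu)).
- by move=> i; exact: measurable_cons_preimage.
- apply/trivIsetP => /= i j _ _ ij; rewrite -preimage_setI.
  by move/trivIsetP : tF => /(_ _ _ _ _ ij) ->//; rewrite preimage_set0.
- by rewrite -preimage_bigcup; exact: measurable_cons_preimage.
Qed.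

HB.instance Definition _ := isMeasure.Build _ _ _ lebesgue_rVS
  lebesgue_rVS0 lebesgue_rVS_ge0 lebesgue_rVS_sigma_additive.

Let lebesgue_rVS_sigma_finite : sigma_finite setT lebesgue_rVS.
Proof.
have /sigma_finiteP[F [TF ndF Foo]] := sigma_finiteT (@lebesgue_measure R).
have /sigma_finiteP[G [TG ndG Goo]] := sigma_finiteT mu.
pose split (v : 'rV[R]_n.+1) : measurableTypeR R * 'rV[R]_n :=
  (v ord0 ord0, \row_i v ord0 (lift ord0 i)).
have msplit : measurable_fun setT split.
  apply/measurable_fun_pairP; split.
    exact: (measurable_coord (T := R)).
  apply: measurable_fun_coord => i.
  rewrite (_ : (fun _ => _) = (fun v : 'rV[R]_n.+1 => v ord0 (lift ord0 i))).
    exact: measurable_coord.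
  by apply/funext => v /=; rewrite mxE.
have consK : cancel (@rV_cons n) split.
  move=> [x v]; rewrite /split rV_cons0; congr pair.
  by apply/rowP => i; rewrite mxE rV_consS.
exists (fun i => split @^-1` (F i `*` G i)).
  apply/esym/seteqP; split => // v _.
  have [k _ Fk] : (\bigcup_k F k) (split v).1 by rewrite -TF.
  have [l _ Gl] : (\bigcup_k G k) (split v).2 by rewrite -TG.
  exists (maxn k l) => //; split.
    by move: Fk; exact/subsetPset/ndF/leq_maxl.
  by move: Gl; exact/subsetPset/ndG/leq_maxr.
move=> i; have [mF Fi] := Foo i; have [mG Gi] := Goo i; split.
  by rewrite -[X in measurable X]setTI; apply: msplit => //; exact: measurableX.
rewrite /lebesgue_rVS /pushforward -comp_preimage.
have -> : split \o @rV_cons n = id by apply/funext; exact: consK.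
by rewrite preimage_id product_measure1E// lte_mul_pinfty// ge0_fin_numE.
Qed.

HB.instance Definition _ := @Measure_isSigmaFinite.Build _ _ _
  lebesgue_rVS lebesgue_rVS_sigma_finite.

End lebesgue_rVS.

(* n-dimensional Lebesgue measure on the Borel sets of R^n, built coordinate by
   coordinate as a product measure. `lebesgue_rV_box` gives its value on boxes. *)
Fixpoint lebesgue_rV n : {sigma_finite_measure set 'rV[R]_n -> \bar R} :=
  match n with
  | 0 => \d_(0 : 'rV[R]_0)
  | n'.+1 => lebesgue_rVS (lebesgue_rV n')
  end.

Lemma lebesgue_rV_box n (a b : 'rV[R]_n) : (forall i, a ord0 i <= b ord0 i) ->
  lebesgue_rV n [set x : 'rV[R]_n | forall i, x ord0 i \in `[a ord0 i, b ord0 i]] =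
  (\prod_i (b ord0 i - a ord0 i))%:E.
Proof.
elim: n a b => [|n IH] a b ab.
  by rewrite big_ord0 /= diracE mem_set//; case.
pose tl (v : 'rV[R]_n.+1) : 'rV[R]_n := \row_i v ord0 (lift ord0 i).
have tlE v i : tl v ord0 i = v ord0 (lift ord0 i) by rewrite mxE.
rewrite /= /lebesgue_rVS /pushforward.
rewrite (_ : _ @^-1` _ = ([set` `[a ord0 ord0, b ord0 ord0]] : set R) `*`
   [set x : 'rV[R]_n | forall i, x ord0 i \in `[tl a ord0 i, tl b ord0 i]]).
  rewrite product_measure1E//.
  - rewrite IH => [|i]; last by rewrite !tlE.
    rewrite [X in (X * _)%E](lebesgue_measure_itv `[a ord0 ord0, b ord0 ord0]) /= lte_fin.
    rewrite big_ord_recl EFinM.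
    under eq_bigr do rewrite !tlE.
    have := ab ord0; rewrite le_eqVlt => /orP[/eqP->|->]; last by rewrite EFinB.
    by rewrite ltxx subrr !mul0e.
  - rewrite (_ : [set x | _] = \bigcap_(i in [set: 'I_n])
       [set x : 'rV[R]_n | x ord0 i \in `[tl a ord0 i, tl b ord0 i]]).
      apply: fin_bigcap_measurable => // i _.
      rewrite -[X in measurable X]setTI.
      by have := @measurable_coord _ R n i measurableT _
        (measurable_itv `[tl a ord0 i, tl b ord0 i]).
    by apply/seteqP; split=> x /= h i; [move=> _|]; exact: h.
apply/seteqP; split => -[x v] /=.
  move=> h; split => [|i]; first by have := h ord0; rewrite rV_cons0.
  by have := h (lift ord0 i); rewrite rV_consS !tlE.
move=> [hx hv] i; have [j ->|->] := unliftP ord0 i.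
  by have := hv j; rewrite rV_consS !tlE.
by rewrite rV_cons0.
Qed.

End lebesgue_rV.
Arguments lebesgue_rV {R} n.

(* The norm of the library on 'rV[R]_n is the sup norm; all the norms and
   diameters below are Euclidean. *)
Section euclidean.
Context {R : realType} {n : nat}.

Definition dotv (x y : 'rV[R]_n) : R := \sum_i x ord0 i * y ord0 i.

Definition norm2 (x : 'rV[R]_n) : R := Num.sqrt (dotv x x).

Definition Ball (r : R) : set 'rV[R]_n := [set v | norm2 v <= r].

Definition diameter (A : set 'rV[R]_n) : \bar R :=
  ereal_sup [set (norm2 (p.1 - p.2))%:E | p in A `*` A].

Definition gradient (f : 'rV[R]_n -> R) (x : 'rV[R]_n) : 'rV[R]_n :=
  \row_m 'D_(delta_mx ord0 m) f x.

End euclidean.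

Section lorenz96.
Context {R : realType} {d : nat}.
Implicit Types u v : 'rV[R]_d.

Definition lorenz96_A : 'M[R]_d := 1%:M.

Definition lorenz96_f : 'rV[R]_d := const_mx 8.

(* `ordS` and `ord_pred` are successor and predecessor modulo d. *)
Definition lorenz96_B u v : 'rV[R]_d :=
  \row_i (- (2^-1 * (v ord0 (ord_pred i) * u ord0 (ordS i)
                    + u ord0 (ord_pred i) * v ord0 (ordS i)
                    - v ord0 (ord_pred (ord_pred i)) * u ord0 (ord_pred i)
                    - u ord0 (ord_pred (ord_pred i)) * v ord0 (ord_pred i)))).

Definition lorenz96 v : 'rV[R]_d :=
  - (v *m lorenz96_A^T) - lorenz96_B v v + lorenz96_f.

Definition trapping_radius (r : R) : Prop :=
  0 < r /\ exists2 delta : R, 0 < delta &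
    forall v, r <= norm2 v <= r + delta -> dotv (lorenz96 v) v <= 0.

End lorenz96.

Section flow.
Context {R : realType} {d : nat}.

(* Psi is the flow of du/dt = F u on the whole time axis. For F = lorenz96 it
   exists and is unique: F is a polynomial and dotv (lorenz96_B v v) v = 0, so
   that the norm of a solution grows at most exponentially in both directions
   of time. *)
Definition is_flow (F : 'rV[R]_d -> 'rV[R]_d) (Psi : R -> 'rV[R]_d -> 'rV[R]_d)
    : Prop :=
  forall v, Psi 0 v = v /\
    forall t : R, is_derive t (1 : R) (fun s => Psi s v) (F (Psi t v)).

Definition time_derivative (Psi : R -> 'rV[R]_d -> 'rV[R]_d) (i : nat)
    (v : 'rV[R]_d) : 'rV[R]_d :=
  derive1n i (fun t : R => Psi t v) 0.

End flow.

Section observations.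
Context {R : realType} {d dobs : nat}.

Definition obs_mx : 'M[R]_(dobs, d) :=
  \matrix_(i, j) (((i : nat) == j) && (i < 3)%N)%:R.

(* H v, for a row vector v. *)
Definition obs (v : 'rV[R]_d) : 'rV[R]_dobs := v *m obs_mx^T.

Definition observations (Psi : R -> 'rV[R]_d -> 'rV[R]_d) (h : R) (u : 'rV[R]_d)
    (k : nat) (z : nat -> 'rV[R]_dobs) : k.+1.-tuple 'rV[R]_dobs :=
  [tuple obs (Psi (i%:R * h) u) + z i | i < k.+1].

End observations.

Definition prob_density {R : realType} {n} (f : 'rV[R]_n -> R) : Prop :=
  [/\ measurable_fun setT f, forall x, 0 <= f x &
      (\int[lebesgue_rV n]_x (f x)%:E = 1)%E].

Section noise.
Context {R : realType} {dobs : nat} {disp} {Omega : measurableType disp}.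
Variables (P : probability Omega R) (Z : nat -> Omega -> 'rV[R]_dobs).

Definition has_density (eta : 'rV[R]_dobs -> R) : Prop :=
  prob_density eta /\
  forall i (A : set 'rV[R]_dobs), measurable A ->
    (P (Z i @^-1` A) = \int[lebesgue_rV dobs]_(z in A) (eta z)%:E)%E.

Definition independent : Prop :=
  forall (s : seq nat) (A : nat -> set 'rV[R]_dobs), uniq s ->
    (forall i, measurable (A i)) ->
    (P (\big[setI/setT]_(i <- s) (Z i @^-1` A i)) =
     \prod_(i <- s) P (Z i @^-1` A i))%E.

Definition centered : Prop :=
  forall i l, P.-integrable setT (fun w => (Z i w ord0 l)%:E) /\
    ('E_P[fun w => Z i w ord0 l] = 0)%E.

Definition noise_model (eta : 'rV[R]_dobs -> R) : Prop :=
  [/\ forall i, measurable_fun setT (Z i), has_density eta, independent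
    & centered].

(* A density is only determined up to a null set, while the supports of the
   smoother and of the filter depend on its values at every point: for errors
   bounded by eps the density is taken to vanish off the ball of radius eps. *)
Definition bounded_noise (eta : 'rV[R]_dobs -> R) (eps : R) : Prop :=
  (forall i, {ae P, forall w, norm2 (Z i w) <= eps}) /\
  (forall z, eps < norm2 z -> eta z = 0).

End noise.

Definition is_prior {R : realType} {d} (r : R) (q : 'rV[R]_d -> R) : Prop :=
  prob_density q /\ forall v, ~ Ball r v -> q v = 0.

Section smoother_filter.
Context {R : realType} {d dobs : nat}.
Variables (Psi : R -> 'rV[R]_d -> 'rV[R]_d) (r : R) (q : 'rV[R]_d -> R)
  (eta : 'rV[R]_dobs -> R) (h : R) (k : nat) (y : k.+1.-tuple 'rV[R]_dobs).

Let t (i : nat) : R := i%:R * h.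

Definition smoother_weight (v : 'rV[R]_d) : R :=
  if v \in Ball r then
    q v * \prod_(i < k.+1) eta (tnth y i - obs (Psi (t i) v))
  else 0.

Definition filter_weight (v : 'rV[R]_d) : R :=
  if v \in Psi (t k) @` Ball r then
    (\prod_(i < k.+1) eta (tnth y i - obs (Psi (t i - t k) v)))
      * \det ('J (Psi (- t k)) v) * q (Psi (- t k) v)
  else 0.

(* If g is not integrable, or integrates to 0, then no mu qualifies. *)
Definition density_proportional_to (g mu : 'rV[R]_d -> R) : Prop :=
  prob_density mu /\ exists2 c : R, 0 < c & forall v, mu v = c * g v.

Definition is_smoother := density_proportional_to smoother_weight.

Definition is_filter := density_proportional_to filter_weight.

End smoother_filter.

Definition density_support {R : realType} {d} (mu : 'rV[R]_d -> R) :
  set 'rV[R]_d := [set v | mu v != 0].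

(* Main.v *)
Require Import Defs.
From HB Require Import structures.
From mathcomp Require Import all_boot all_order all_algebra.
From mathcomp Require Import all_classical all_reals all_analysis.
From mathcomp Require Import measurable_realfun.
From mathcomp Require Import ring lra zify.
Import Order.TTheory GRing.Theory Num.Theory numFieldNormedType.Exports.
Local Open Scope classical_set_scope.
Local Open Scope ring_scope.

(** Why the result holds. For a solution of the Lorenz '96 system, the equation
    u_i' = u_(i-1) (u_(i+1) - u_(i-2)) - u_i + 8 expresses u_(i+1) through
    u_(i-2), u_(i-1), u_i and u_i', provided that u_(i-1) is nonzero. Knowing j
    derivatives of the first three coordinates, one therefore finds j - 1 derivatives
    of the fourth, j - 2 of the fifth, and so on up to the last coordinate, as long as
    j >= d - 3 and no coordinate of the initial point vanishes, a condition that only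
    excludes a null set.

    This argument is run quantitatively. Fix u with nonzero coordinates and let v range
    over the ball. Calling a polynomial controlled when its increment between u and v
    is at most a constant times the discrepancy of the observed derivatives, controlled
    jets are stable under sums, products and division by a polynomial that is nonzero
    at u, which yields
      norm1 (v - u) <= C * jet_gap j v u        (jet_stability).
    This single inequality contains the first part: it gives uniqueness at once, and,
    read for v = u + s x with s tending to 0, that no x <> 0 is orthogonal to all
    gradients.

    For sampled observations, derivatives at 0 are replaced by finite differences of
    the difference of two trajectories. By the mean value theorem the replacement costs
    h times a derivative of higher order, and this derivative is O(norm1 (v - u)) since
    derivatives along the flow are polynomials of the state and the flow is Lipschitz
    in the initial point (energy bound and Gronwall's inequality). For small h the
    error is absorbed, and the observations at times 0, h, ..., kh determine v with a
    Lipschitz inverse at u (obs_stability).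

    With errors bounded by eps, an initial point in the support of the smoother has
    observations within 2 eps of those of u, up to constants, hence lies within O(eps)
    of u; the group property and the Lipschitz bound of the flow give the filter. With
    square integrable errors, candidate initial points are taken from a dense sequence
    and ranked by their misfit to the data; the upper limit of the best candidates is a
    measurable estimator whose error is at most a constant times the sum of the sizes of
    the errors, for every realization (state_estimator_error), and squaring and
    integrating this bound concludes. *)

Set Implicit Arguments.
Unset Strict Implicit.
Unset Printing Implicit Defensive.

(** * Norms on row vectors *)

Section norms.
Context {R : realType} {n : nat}.
Implicit Types x y z : 'rV[R]_n.

(** The sum norm carries the estimates: its triangle inequality is immediate, and
    norm1_le_norm2 and norm2_le_norm1 translate to and from the Euclidean norm. *)
Definition norm1 x : R := \sum_i `|x ord0 i|.

Lemma norm1_ge0 x : 0 <= norm1 x.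
Proof. by apply: sumr_ge0 => i _; exact: normr_ge0. Qed.

Lemma norm1_distC x y : norm1 (x - y) = norm1 (y - x).
Proof. by apply: eq_bigr => i _; rewrite !mxE distrC. Qed.

Lemma norm1_dist_triangle y x z : norm1 (x - z) <= norm1 (x - y) + norm1 (y - z).
Proof.
rewrite /norm1 -big_split /=; apply: ler_sum => i _; rewrite !mxE.
exact: ler_distD.
Qed.

Lemma ler_coord_norm1 x i : `|x ord0 i| <= norm1 x.
Proof. by rewrite /norm1 (bigD1 i)//= lerDl sumr_ge0. Qed.

Lemma dotvv_ge0 x : 0 <= dotv x x.
Proof. by apply: sumr_ge0 => i _; rewrite -expr2 sqr_ge0. Qed.

Lemma norm2_ge0 x : 0 <= norm2 x.
Proof. exact: sqrtr_ge0. Qed.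

Lemma sqr_norm2 x : norm2 x ^+ 2 = dotv x x.
Proof. by rewrite sqr_sqrtr// dotvv_ge0. Qed.

Lemma norm2_le_sqrP x (a : R) : 0 <= a -> (norm2 x <= a) = (dotv x x <= a ^+ 2).
Proof. by move=> a0; rewrite -sqr_norm2 ler_sqr ?nnegrE ?norm2_ge0. Qed.

Lemma ler_coord_norm2 x i : `|x ord0 i| <= norm2 x.
Proof.
rewrite -sqrtr_sqr ler_wsqrtr// /dotv (bigD1 i)//= -expr2 lerDl.
by apply: sumr_ge0 => k _; rewrite -expr2 sqr_ge0.
Qed.

Lemma norm1_le_norm2 x : norm1 x <= n%:R * norm2 x.
Proof.
rewrite mulr_natl -[X in _ *+ X]card_ord -sumr_const.
by apply: ler_sum => i _; exact: ler_coord_norm2.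
Qed.

Lemma norm2_le_norm1 x : norm2 x <= norm1 x.
Proof.
rewrite norm2_le_sqrP ?norm1_ge0// expr2 {2}/norm1 mulr_sumr.
apply: ler_sum => i _; apply: le_trans (ler_norm _) _; rewrite normrM.
by apply: ler_wpM2r => //; exact: ler_coord_norm1.
Qed.

End norms.

(** * Polynomials and their derivatives along the flow *)

Section polynomial_observables.
Context {R : realType} {d : nat}.

(** Polynomials in the coordinates, kept as syntax so that differentiation along
    the flow is a recursive function and bounds go by structural induction. *)
Inductive pexp : Type :=
| PCst of R
| PVar of 'I_d
| PAdd of pexp & pexp
| PMul of pexp & pexp.

Fixpoint peval (e : pexp) (v : 'rV[R]_d) : R :=
  match e with
  | PCst c => c
  | PVar i => v ord0 i
  | PAdd a b => peval a v + peval b v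
  | PMul a b => peval a v * peval b v
  end.

Definition PSub a b := PAdd a (PMul (PCst (-1)) b).

Definition lorenz96_pexp (i : 'I_d) : pexp :=
  PAdd (PSub (PMul (PVar (ord_pred i))
                   (PSub (PVar (ordS i)) (PVar (ord_pred (ord_pred i)))))
             (PVar i)) (PCst 8).

(** The Lie derivative along the Lorenz '96 vector field: the chain rule makes
    iter i lie e the polynomial giving the i-th time derivative of e along every
    trajectory. *)
Fixpoint lie (e : pexp) : pexp :=
  match e with
  | PCst c => PCst 0
  | PVar i => lorenz96_pexp i
  | PAdd a b => PAdd (lie a) (lie b)
  | PMul a b => PAdd (PMul (lie a) b) (PMul a (lie b))
  end.

Lemma peval_lorenz96 i v : peval (lorenz96_pexp i) v = lorenz96 v ord0 i.
Proof.
rewrite /lorenz96_pexp /lorenz96 /lorenz96_A /lorenz96_B /lorenz96_f /=.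
by rewrite trmx1 mulmx1 !mxE; field.
Qed.

Lemma peval_bounded (rho : R) e :
  exists2 C : R, 0 <= C & forall v, norm2 v <= rho -> `|peval e v| <= C.
Proof.
elim: e => [c|i|a [A A0 hA] b [B B0 hB]|a [A A0 hA] b [B B0 hB]] /=.
- by exists `|c|.
- exists `|rho| => // v hv; apply: le_trans (ler_coord_norm2 _ _) _.
  exact: le_trans hv (ler_norm _).
- exists (A + B); first exact: addr_ge0.
  by move=> v hv; apply: le_trans (ler_normD _ _) _; rewrite lerD ?hA ?hB.
- exists (A * B); first exact: mulr_ge0.
  by move=> v hv; rewrite normrM ler_pM ?hA ?hB.
Qed.

Lemma peval_lipschitz (rho : R) e :
  exists2 K : R, 0 <= K & forall v w, norm2 v <= rho -> norm2 w <= rho ->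
    `|peval e v - peval e w| <= K * norm1 (v - w).
Proof.
elim: e => [c|i|a [A A0 hA] b [B B0 hB]|a [A A0 hA] b [B B0 hB]] /=.
- by exists 0 => // v w _ _; rewrite subrr normr0 mul0r.
- exists 1 => // v w _ _; rewrite mul1r.
  by have := ler_coord_norm1 (v - w) i; rewrite !mxE.
- exists (A + B) => [|v w hv hw]; first exact: addr_ge0.
  rewrite opprD addrACA mulrDl; apply: le_trans (ler_normD _ _) _.
  by rewrite lerD ?hA ?hB.
- have [Ca Ca0 hCa] := peval_bounded rho a.
  have [Cb Cb0 hCb] := peval_bounded rho b.
  exists (A * Cb + Ca * B) => [|v w hv hw]; first by rewrite addr_ge0 ?mulr_ge0.
  have -> : peval a v * peval b v - peval a w * peval b w =
    (peval a v - peval a w) * peval b v + peval a w * (peval b v - peval b w).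
    by ring.
  apply: le_trans (ler_normD _ _) _; rewrite !normrM mulrDl lerD//.
    by rewrite mulrAC ler_pM ?hA ?hCb.
  by rewrite -mulrA ler_pM ?hB ?hCa.
Qed.

Lemma differentiable_peval e x : differentiable (peval e) x.
Proof.
elim: e => [c|i|a ha b hb|a ha b hb].
- exact: (@differentiable_cst _ _ _ c).
- exact: differentiable_coord.
- exact: (differentiableD ha hb).
- exact: (differentiableM ha hb).
Qed.

End polynomial_observables.
Arguments pexp : clear implicits.

Section flow_derivatives.
Context {R : realType} {d : nat}.
Variables (Psi : R -> 'rV[R]_d -> 'rV[R]_d) (hPsi : is_flow lorenz96 Psi).

Lemma flow0 v : Psi 0 v = v.
Proof. by have [] := hPsi v. Qed.

Lemma is_derive_flow_coord v i (t : R) :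
  is_derive t (1 : R) (fun s => Psi s v ord0 i) (lorenz96 (Psi t v) ord0 i).
Proof.
have [_ /(_ t) [dP vP]] := hPsi v.
have dPi := (derivable_mxP (fun s => Psi s v) t (1 : R)).1 dP ord0 i.
by apply: (DeriveDef dPi); rewrite -vP derive_mx// !mxE.
Qed.

Lemma is_derive_peval_flow e v (t : R) :
  is_derive t (1 : R) (fun s => peval e (Psi s v)) (peval (lie e) (Psi t v)).
Proof.
elim: e => [c|i|a ha b hb|a ha b hb].
- exact: is_derive_cst.
- by rewrite [peval _ _]peval_lorenz96; exact: is_derive_flow_coord.
- exact: (is_deriveD ha hb).
- apply: (is_derive_eq (is_deriveM ha hb)) => /=.
  by rewrite /GRing.scale /=; ring.
Qed.

Lemma derive1n_flow i v : derive1n i (fun t => Psi t v) =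
  fun t => \row_m peval (iter i lie (PVar m)) (Psi t v).
Proof.
elim: i => [|i IH].
  by apply/funext => t; apply/rowP => m; rewrite mxE.
rewrite derive1nS IH; apply/funext => t; rewrite derive1E.
have dv (m : 'I_d) := is_derive_peval_flow (iter i lie (PVar m)) v t.
rewrite derive_mx.
  apply/rowP => m; rewrite !mxE /= -(@derive_val _ _ _ _ _ _ _ (dv m)).
  by congr ('D_1 _ t); apply/funext => s; rewrite mxE.
apply/derivable_mxP => a m; rewrite (_ : (fun _ => _) =
  fun s => peval (iter i lie (PVar m)) (Psi s v)).
  exact: (@ex_derive _ _ _ _ _ _ _ (dv m)).
by apply/funext => s; rewrite mxE.
Qed.

Lemma time_derivativeE i v m :
  time_derivative Psi i v ord0 m = peval (iter i lie (PVar m)) v.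
Proof. by rewrite /time_derivative derive1n_flow mxE flow0. Qed.

End flow_derivatives.

(** * Recovering a state from the jets of three coordinates *)

Lemma ler_dist_addKr (R : realType) (x y x' y' : R) :
  `|x - x'| <= `|x + y - (x' + y')| + `|y - y'|.
Proof.
by rewrite {1}(_ : x - x' = (x + y - (x' + y')) - (y - y')) ?ler_normB//; ring.
Qed.

Lemma ler_dist_addKl (R : realType) (x y x' y' : R) :
  `|y - y'| <= `|x + y - (x' + y')| + `|x - x'|.
Proof.
by rewrite {1}(_ : y - y' = (x + y - (x' + y')) - (x - x')) ?ler_normB//; ring.
Qed.

Lemma val_ord_pred d (m : 'I_d) : (0 < m)%N -> ord_pred m = m.-1 :> nat.
Proof.
move=> m0; have md := ltn_ord m => /=.
by rewrite (_ : (m + d).-1 = m.-1 + d)%N ?modnDr ?modn_small//; lia.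
Qed.

Section jet_control.
Context {R : realType} {d : nat}.
Variables (r : R) (u : 'rV[R]_d) (M : 'rV[R]_d -> R).
Implicit Types (a b e : pexp R d) (n : nat).

(** M v stands for the distance of v to u in the observed jets; a controlled
    polynomial is one whose value at v is recovered from these jets, with an error
    linear in M. Boundedness of v is what makes products controlled. *)
Definition controlled e := exists2 C : R, 0 <= C &
  forall v, Ball r v -> `|peval e v - peval e u| <= C * M v.

Definition jet_controlled n e := forall i, (i <= n)%N -> controlled (iter i lie e).

Lemma controlledD a b : controlled a -> controlled b -> controlled (PAdd a b).
Proof.
move=> [A A0 hA] [B B0 hB]; exists (A + B) => [|v hv]; first exact: addr_ge0.
rewrite /= opprD addrACA mulrDl; apply: le_trans (ler_normD _ _) _.
by rewrite lerD ?hA ?hB.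
Qed.

Lemma controlledM a b : controlled a -> controlled b -> controlled (PMul a b).
Proof.
move=> [A A0 hA] [B B0 hB]; have [C C0 hC] := peval_bounded r b.
exists (A * C + `|peval a u| * B) => [|v hv]; first by rewrite addr_ge0 ?mulr_ge0.
have -> : peval (PMul a b) v - peval (PMul a b) u =
  (peval a v - peval a u) * peval b v + peval a u * (peval b v - peval b u).
  by rewrite /=; ring.
apply: le_trans (ler_normD _ _) _; rewrite !normrM mulrDl lerD//.
  by rewrite mulrAC ler_pM ?hA ?hC.
by rewrite -mulrA ler_wpM2l ?hB.
Qed.

(** Division only needs the factor to be nonzero at the fixed point u, not at v:
    a(u)(b(v) - b(u)) = ((ab)(v) - (ab)(u)) - (a(v) - a(u)) b(v). *)
Lemma controlled_div a b : peval a u != 0 ->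
  controlled a -> controlled (PMul a b) -> controlled b.
Proof.
move=> au0 [A A0 hA] [B B0 hB]; have [C C0 hC] := peval_bounded r b.
exists (`|peval a u|^-1 * (B + A * C)) => [|v hv].
  by rewrite mulr_ge0 ?invr_ge0 ?addr_ge0 ?mulr_ge0.
rewrite -mulrA -[leLHS]mul1r -(mulVf (_ : `|peval a u| != 0)) ?normr_eq0//.
rewrite -mulrA ler_wpM2l ?invr_ge0// -normrM.
have -> : peval a u * (peval b v - peval b u) =
  (peval (PMul a b) v - peval (PMul a b) u)
  - (peval a v - peval a u) * peval b v by rewrite /=; ring.
apply: le_trans (ler_normB _ _) _; rewrite [leRHS]mulrDl lerD ?hB// normrM.
by rewrite mulrAC ler_pM ?hA ?hC.
Qed.

Lemma jet_controlledW m n e : (m <= n)%N -> jet_controlled n e -> jet_controlled m e.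
Proof. by move=> mn h i im; apply: h; exact: leq_trans mn. Qed.

Lemma jet_controlled_lie n e : jet_controlled n.+1 e -> jet_controlled n (lie e).
Proof. by move=> h i i_n; rewrite -iterSr; exact: h. Qed.

Lemma jet_controlledS n e :
  controlled e -> jet_controlled n (lie e) -> jet_controlled n.+1 e.
Proof. by move=> h0 h [|i] i_n //; rewrite iterSr; exact: h. Qed.

Lemma iter_lieD i a b : iter i lie (PAdd a b) = PAdd (iter i lie a) (iter i lie b).
Proof. by elim: i => //= i ->. Qed.

Lemma jet_controlledD n a b :
  jet_controlled n a -> jet_controlled n b -> jet_controlled n (PAdd a b).
Proof.
move=> ha hb i i_n; rewrite iter_lieD.
by apply: controlledD; [exact: ha|exact: hb].
Qed.

Lemma controlled_cst c : controlled (PCst c).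
Proof. by exists 0 => // v _ /=; rewrite subrr normr0 mul0r. Qed.

Lemma jet_controlled_cst n c : jet_controlled n (PCst c).
Proof.
elim: n c => [|n IH] c; first by move=> [|//] _; exact: controlled_cst.
by apply: jet_controlledS; [exact: controlled_cst|exact: IH].
Qed.

Lemma jet_controlledM n a b :
  jet_controlled n a -> jet_controlled n b -> jet_controlled n (PMul a b).
Proof.
elim: n a b => [|n IH] a b ha hb.
  by move=> [|//] _; apply: controlledM; [exact: (ha 0%N)|exact: (hb 0%N)].
apply: jet_controlledS.
  by apply: controlledM; [exact: (ha 0%N)|exact: (hb 0%N)].
apply: jet_controlledD; apply: IH => //;
  by [exact: jet_controlled_lie|exact: jet_controlledW (leqnSn n) _].
Qed.

Lemma jet_controlledN n a :
  jet_controlled n a -> jet_controlled n (PMul (PCst (-1)) a).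
Proof. by apply: jet_controlledM; exact: jet_controlled_cst. Qed.

Lemma jet_controlled_addKr n a b :
  jet_controlled n (PAdd a b) -> jet_controlled n b -> jet_controlled n a.
Proof.
move=> hab hb i i_n.
have [A A0 hA] := hab i i_n; have [B B0 hB] := hb i i_n.
exists (A + B) => [|v hv]; first exact: addr_ge0.
have := hA v hv; rewrite iter_lieD /= => hA'.
rewrite mulrDl; apply: le_trans (lerD hA' (hB v hv)).
exact: ler_dist_addKr.
Qed.

Lemma jet_controlled_addKl n a b :
  jet_controlled n (PAdd a b) -> jet_controlled n a -> jet_controlled n b.
Proof.
move=> hab hb i i_n.
have [A A0 hA] := hab i i_n; have [B B0 hB] := hb i i_n.
exists (A + B) => [|v hv]; first exact: addr_ge0.
have := hA v hv; rewrite iter_lieD /= => hA'.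
rewrite mulrDl; apply: le_trans (lerD hA' (hB v hv)).
exact: ler_dist_addKl.
Qed.

(** The derivative of ab is a'b + ab', so that the jets of b of lower order control
    a'b, and dividing ab' by a gains one order. *)
Lemma jet_controlled_div n a b : peval a u != 0 ->
  jet_controlled n a -> jet_controlled n (PMul a b) -> jet_controlled n b.
Proof.
move=> au0; elim: n b => [|n IH] b ha hab.
  by move=> [|//] _; apply: (controlled_div au0 (ha 0%N _) (hab 0%N _)).
have hb : jet_controlled n b.
  by apply: IH; apply: jet_controlledW (leqnSn n) _.
apply: jet_controlledS; first exact: (hb 0%N).
apply: IH; first exact: jet_controlledW (leqnSn n) _.
apply: jet_controlled_addKl (jet_controlled_lie hab) _.
by apply: jet_controlledM => //; exact: jet_controlled_lie.
Qed.

(** The equation u_i' = u_(i-1) (u_(i+1) - u_(i-2)) - u_i + 8 can be solved for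
    u_(i+1) when u_(i-1) is nonzero; it reads one derivative of u_i, hence the loss
    of one order. *)
Lemma jet_controlled_next n (i : 'I_d) : u ord0 (ord_pred i) != 0 ->
  jet_controlled n.+1 (PVar i) -> jet_controlled n (PVar (ord_pred i)) ->
  jet_controlled n (PVar (ord_pred (ord_pred i))) ->
  jet_controlled n (PVar (ordS i)).
Proof.
move=> ui0 hi hi1 hi2.
have := jet_controlled_addKr (jet_controlled_lie hi) (@jet_controlled_cst n 8).
move=> /jet_controlled_addKr /(_ (jet_controlledN (jet_controlledW (leqnSn n) hi))).
move=> /(jet_controlled_div (a := PVar _) ui0 hi1) /jet_controlled_addKr.
by apply; exact: jet_controlledN.
Qed.

(** Climbing from the three observed coordinates to the m-th one takes m - 2 steps,
    each costing one order of the jets. The last coordinate costs d - 3 orders,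
    which is where the bound on j comes from. *)
Lemma jet_controlled_var j (hu : forall m, u ord0 m != 0)
    (hobs : forall m : 'I_d, (m < 3)%N -> jet_controlled j (PVar m)) :
  forall (m : 'I_d) n, (n + (m - 2) <= j)%N -> jet_controlled n (PVar m).
Proof.
move=> m; have [k km] := ubnP (m : nat); elim: k => // k IH in m km *.
move=> n nmj; have [m3|m3] := ltnP m 3.
  by apply: (jet_controlledW _ (hobs m m3)); apply: leq_trans nmj; rewrite leq_addr.
have md := ltn_ord m.
have pm : ord_pred m = m.-1 :> nat by rewrite val_ord_pred//; lia.
have ppm : ord_pred (ord_pred m) = m.-2 :> nat.
  by rewrite val_ord_pred ?pm//; lia.
have pppm : ord_pred (ord_pred (ord_pred m)) = m.-2.-1 :> nat.
  by rewrite val_ord_pred ?ppm//; lia.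
rewrite -(ord_predK m); apply: jet_controlled_next; first exact: hu.
- by apply: IH; rewrite pm; lia.
- by apply: IH; rewrite ppm; lia.
- by apply: IH; rewrite pppm; lia.
Qed.

End jet_control.

Section jet_stability.
Context {R : realType} {d : nat}.
Variables (r : R) (j : nat) (hj : (d - 3 <= j)%N).

Definition jet_gap (v u : 'rV[R]_d) : R :=
  \sum_(i < j.+1) \sum_(m < d | (m < 3)%N)
    `|peval (iter i lie (PVar m)) v - peval (iter i lie (PVar m)) u|.

Lemma jet_gap_ge0 v u : 0 <= jet_gap v u.
Proof. by apply: sumr_ge0 => i _; apply: sumr_ge0. Qed.

(** The central estimate: the first j derivatives of the observed coordinates
    determine v with a Lipschitz inverse at u. Uniqueness, the full rank of the
    gradients and the accuracy of sampled observations all follow from it. *)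
Lemma jet_stability (u : 'rV[R]_d) (hu : forall m, u ord0 m != 0) :
  exists2 C : R, 0 < C & forall v, Ball r v -> norm1 (v - u) <= C * jet_gap v u.
Proof.
have hobs (m : 'I_d) : (m < 3)%N -> jet_controlled r u (jet_gap ^~ u) j (PVar m).
  move=> m3 i ij; exists 1 => // v hv; rewrite mul1r /jet_gap.
  rewrite (bigD1 (Ordinal (ij : (i < j.+1)%N)))//= (bigD1 m)//= -addrA lerDl addr_ge0//.
    exact: sumr_ge0.
  by apply: sumr_ge0 => ? _; apply: sumr_ge0.
have hvar (m : 'I_d) : controlled r u (jet_gap ^~ u) (PVar m).
  have := jet_controlled_var hu hobs (m := m) (n := 0%N).
  by move/(_ _ 0%N (leqnn _)); apply; have := ltn_ord m; lia.
pose C m := sval (cid2 (hvar m)).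
exists (1 + \sum_m C m) => [|v hv].
  by rewrite ltr_wpDr// sumr_ge0// => m _; rewrite /C; case: cid2.
rewrite mulrDl mul1r ler_wpDl ?jet_gap_ge0// mulr_suml; apply: ler_sum => m _.
by rewrite /C; case: cid2 => c c0 hc /=; have := hc v hv; rewrite !mxE.
Qed.

End jet_stability.

(** * Growth, stability and uniqueness of solutions *)

Section ode_tools.
Context {R : realType}.

Lemma is_derive_continuous (g dg : R -> R) :
  (forall t : R, is_derive t (1 : R) g (dg t)) -> continuous g.
Proof.
move=> h t; apply: differentiable_continuous.
by apply/derivable1_diffP; exact: (@ex_derive _ _ _ _ _ _ _ (h t)).
Qed.

Lemma is_derive_MVT (g dg : R -> R) (a b : R) : a <= b ->
  (forall t : R, is_derive t (1 : R) g (dg t)) ->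
  exists2 c, a <= c <= b & g b - g a = dg c * (b - a).
Proof.
move=> ab h; have [] := MVT_segment ab (fun t _ => h t).
  exact: continuous_subspaceT (is_derive_continuous h).
by move=> c; rewrite in_itv /= => cab E; exists c.
Qed.

(** The function g(t) exp(- K t) has a nonpositive derivative. *)
Lemma gronwall (g dg : R -> R) (K T : R) : 0 <= T ->
  (forall t : R, is_derive t (1 : R) g (dg t)) ->
  (forall t, 0 <= t <= T -> dg t <= K * g t) -> g T <= expR (K * T) * g 0.
Proof.
move=> T0 h hle.
have hG (t : R) : is_derive t (1 : R) (fun s => g s * expR (- K * s))
    ((dg t - K * g t) * expR (- K * t)).
  have hE : is_derive t (1 : R) (fun s => expR (- K * s)) (- K * expR (- K * t)).
    apply: (is_derive_eq (is_derive1_comp (g := fun s => - K * s)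
      (is_derive_expR _) (is_deriveZ (- K) (is_derive_id t 1)))).
    by rewrite /GRing.scale /= mulr1 mulrC.
  by apply: (is_derive_eq (is_deriveM (h t) hE)); rewrite /GRing.scale /=; ring.
have [c cT E] := is_derive_MVT T0 hG.
have : g T * expR (- K * T) <= g 0.
  move: E; rewrite mulr0 expR0 mulr1 subr0 -subr_le0 => ->.
  by rewrite mulr_le0_ge0// mulr_le0_ge0 ?expR_ge0// subr_le0 hle.
by rewrite mulNr expRN ler_pdivrMr ?expR_gt0// mulrC.
Qed.

Lemma is_derive_dotvv n (x : R -> 'rV[R]_n) (dx : 'rV[R]_n) (t : R) :
  (forall i, is_derive t (1 : R) (fun s => x s ord0 i) (dx ord0 i)) ->
  is_derive t (1 : R) (fun s => dotv (x s) (x s)) (2 * dotv (x t) dx).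
Proof.
move=> h; rewrite (_ : (fun _ => _) =
  \sum_i ((fun s => x s ord0 i) * (fun s => x s ord0 i))); last first.
  by apply/funext => s; rewrite fct_sumE.
apply: (is_derive_eq (is_derive_sum (fun i => is_deriveM (h i) (h i)))).
by rewrite mulr_sumr; apply: eq_bigr => i _; rewrite /GRing.scale /=; ring.
Qed.

End ode_tools.

Section lorenz96_flow.
Context {R : realType} {d : nat}.

Lemma lorenz96_lipschitz (rho : R) : exists2 K : R, 0 <= K &
  forall (v w : 'rV[R]_d) i, norm2 v <= rho -> norm2 w <= rho ->
    `|lorenz96 v ord0 i - lorenz96 w ord0 i| <= K * norm1 (v - w).
Proof.
have h (i : 'I_d) := peval_lipschitz rho (@lorenz96_pexp R _ i).
pose K i := sval (cid2 (h i)).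
have K0 i : 0 <= K i by rewrite /K; case: cid2.
exists (\sum_i K i) => [|v w i hv hw]; first exact: sumr_ge0.
rewrite -!peval_lorenz96 (bigD1 i)//= mulrDl ler_wpDr//.
  by rewrite mulr_ge0 ?norm1_ge0// sumr_ge0.
by rewrite /K; case: cid2 => k k0 hk /=; exact: hk.
Qed.

(** The sign sg allows solutions run backward in time (sg = -1) to be treated
    together with forward ones. *)
Definition solution (sg : R) (x : R -> 'rV[R]_d) : Prop :=
  forall (t : R) i,
    is_derive t (1 : R) (fun s => x s ord0 i) (sg * lorenz96 (x t) ord0 i).

(** Inside a ball the vector field is Lipschitz, and Gronwall's inequality applies to
    the squared distance of two solutions. The constant K is common to all
    solutions in the ball. *)
Lemma solution_lipschitz (sg rho : R) : exists K : R,
  forall (x y : R -> 'rV[R]_d) (T : R), solution sg x -> solution sg y ->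
  0 <= T -> (forall t, 0 <= t <= T -> norm2 (x t) <= rho /\ norm2 (y t) <= rho) ->
  norm2 (x T - y T) ^+ 2 <= expR (K * T) * norm2 (x 0 - y 0) ^+ 2.
Proof.
have [K K0 hK] := lorenz96_lipschitz rho.
exists (2 * (`|sg| * K) * d%:R ^+ 2) => x y T hx hy T0 hb; rewrite !sqr_norm2.
apply: (gronwall (g := fun t => dotv (x t - y t) (x t - y t))) => // [t|t tT].
  apply: (@is_derive_dotvv _ _ (fun s => x s - y s)
    (sg *: (lorenz96 (x t) - lorenz96 (y t)))) => i.
  rewrite (_ : (fun _ => _) = (fun s => x s ord0 i) - (fun s => y s ord0 i)).
    by apply: (is_derive_eq (is_deriveB (hx t i) (hy t i))); rewrite !mxE; ring.
  by apply/funext => s; rewrite !mxE.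
have [hxt hyt] := hb t tT.
apply: (@le_trans _ _ (2 * (`|sg| * K) * norm1 (x t - y t) ^+ 2)); last first.
  rewrite -[leRHS]mulrA ler_wpM2l ?mulr_ge0// -sqr_norm2 -exprMn.
  by rewrite ler_pXn2r ?nnegrE ?norm1_ge0 ?mulr_ge0 ?norm2_ge0// norm1_le_norm2.
rewrite -!mulrA ler_wpM2l// /dotv.
apply: (@le_trans _ _ (\sum_i `|(x t - y t) ord0 i| * (`|sg| * (K * norm1 (x t - y t))))).
  apply: ler_sum => i _; apply: le_trans (ler_norm _) _; rewrite normrM.
  rewrite ler_wpM2l// !mxE normrM ler_wpM2l//.
  by have := hK _ _ i hxt hyt; rewrite !mxE.
by rewrite -mulr_suml expr2 /norm1 mulrC !mulrA.
Qed.

Lemma solution_bounded sg x (T : R) : solution sg x -> 0 <= T ->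
  exists rho, forall t, 0 <= t <= T -> norm2 (x t) <= rho.
Proof.
move=> hx T0; pose g t := dotv (x t) (x t).
have cg : continuous g.
  apply: (@is_derive_continuous _ _ (fun t => 2 * dotv (x t) (sg *: lorenz96 (x t)))).
  by move=> t; apply: is_derive_dotvv => i; rewrite mxE; exact: hx.
have [c _ hc] := EVT_max T0 (continuous_subspaceT cg).
by exists (norm2 (x c)) => t tT; apply: ler_wsqrtr; apply: hc; rewrite in_itv.
Qed.

(** Two given solutions are bounded on a compact interval, so that the local
    Lipschitz constant suffices. *)
Lemma solution_unique sg x y (T : R) : solution sg x -> solution sg y -> 0 <= T ->
  x 0 = y 0 -> x T = y T.
Proof.
move=> hx hy T0 xy0.
have [rx hrx] := solution_bounded hx T0; have [ry hry] := solution_bounded hy T0.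
have [K hK] := solution_lipschitz sg (Num.max rx ry).
have : norm2 (x T - y T) ^+ 2 <= 0.
  apply: le_trans (hK _ _ _ hx hy T0 _) _.
    by move=> t tT; rewrite !le_max hrx ?hry ?orbT.
  by rewrite xy0 [y 0 - _]subrr [X in _ * X]sqr_norm2 /dotv big1 ?mulr0// => i _; rewrite !mxE mul0r.
move=> h; apply/eqP; rewrite -subr_eq0; apply/eqP/rowP => i; rewrite [RHS]mxE.
have n0 : norm2 (x T - y T) = 0.
  by apply/eqP; rewrite -sqrf_eq0 eq_le h sqr_ge0.
by apply/eqP; rewrite -normr_le0 -n0 ler_coord_norm2.
Qed.

Variables (Psi : R -> 'rV[R]_d -> 'rV[R]_d) (hPsi : is_flow lorenz96 Psi).

Lemma is_derive_comp_affine (g : R -> R) (a c t dg : R) :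
  is_derive (a * t + c) (1 : R) g dg ->
  is_derive t (1 : R) (fun s => g (a * s + c)) (a * dg).
Proof.
move=> h; have ha : is_derive t (1 : R) (fun s => a * s + c) a.
  apply: (is_derive_eq (is_deriveD (is_deriveZ a (is_derive_id t 1))
    (is_derive_cst c t 1))).
  by rewrite /GRing.scale /= mulr1 addr0.
by rewrite mulrC; exact: (is_derive1_comp (g := fun s => a * s + c) h ha).
Qed.

Lemma solution_flow sg c v : solution sg (fun t => Psi (sg * t + c) v).
Proof.
move=> t i; apply: (@is_derive_comp_affine (fun s => Psi s v ord0 i)).
exact: (is_derive_flow_coord hPsi).
Qed.

(** Both sides solve the same equation, forward or backward in time, with the same
    value at time 0. *)
Lemma flowD s t v : Psi t (Psi s v) = Psi (t + s) v.
Proof.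
suff h sg : forall T, 0 <= T -> Psi (sg * T) (Psi s v) = Psi (sg * T + s) v.
  have [t0|/ltW t0] := leP 0 t; first by have := h 1 t t0; rewrite mul1r.
  by have := h (-1) (- t); rewrite oppr_ge0 mulrNN mul1r; exact.
move=> T T0.
have h1 : solution sg (fun t => Psi (sg * t) (Psi s v)).
  have := solution_flow sg 0 (Psi s v).
  by congr solution; apply/funext => x; rewrite addr0.
apply: (solution_unique h1 (solution_flow sg s v) T0).
by rewrite mulr0 add0r flow0.
Qed.

(** The nonlinearity conserves energy: after a cyclic shift of the index the two
    cubic sums cancel. What remains is bounded by 2(8x - x^2) <= 64 in each
    coordinate. *)
Lemma dotv_lorenz96_le (v : 'rV[R]_d) : 2 * dotv v (lorenz96 v) <= 64 * d%:R.
Proof.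
pose a i := v ord0 (ord_pred i).
have nonlinear0 : \sum_i v ord0 i * (a i * (v ord0 (ordS i) - a (ord_pred i))) = 0.
  under eq_bigr do rewrite !mulrBr.
  rewrite sumrB [X in X - _](reindex_inj (can_inj (@ord_predK d))) /=.
  rewrite (eq_bigr (fun i => v ord0 i * (a i * a (ord_pred i)))) ?subrr// => i _.
  by rewrite /a ord_predK; ring.
have -> : dotv v (lorenz96 v) = \sum_i (8 * v ord0 i - v ord0 i ^+ 2).
  rewrite -[RHS]addr0 -[X in _ = _ + X]nonlinear0 -big_split /=; apply: eq_bigr => i _.
  by rewrite -peval_lorenz96 /= /a; ring.
rewrite mulr_sumr mulr_natr -[X in _ <= _ *+ X]card_ord -[leRHS]sumr_const.
apply: ler_sum => i _; rewrite -subr_ge0.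
rewrite (_ : _ - _ = (v ord0 i - 8) ^+ 2 + v ord0 i ^+ 2); last by ring.
by rewrite addr_ge0 ?sqr_ge0.
Qed.

(** The energy grows at most linearly in time, so that trajectories started in a
    ball stay in a common larger ball on every bounded time interval. *)
Lemma flow_bounded (r T : R) : exists rho, forall v t, Ball r v -> 0 <= t <= T ->
  norm2 (Psi t v) <= rho.
Proof.
exists (Num.sqrt (r ^+ 2 + 64 * d%:R * T)) => v t hv /andP[t0 tT].
have r0 : 0 <= r := le_trans (norm2_ge0 v) hv.
apply: ler_wsqrtr.
have hE (s : R) := @is_derive_dotvv _ _ (fun s => Psi s v) _ s
  (is_derive_flow_coord hPsi v ^~ s).
have [c _ E] := is_derive_MVT t0 hE.
rewrite -[leLHS](subrK (dotv (Psi 0 v) (Psi 0 v))) E subr0 flow0// addrC.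
apply: lerD; first by rewrite -norm2_le_sqrP.
apply: le_trans (ler_wpM2r t0 (dotv_lorenz96_le _)) _.
by rewrite ler_wpM2l// mulr_ge0.
Qed.

Lemma flow_lipschitz (r T : R) : exists2 K : R, 0 <= K &
  forall v w t, Ball r v -> Ball r w -> 0 <= t <= T ->
    norm1 (Psi t v - Psi t w) <= K * norm1 (v - w).
Proof.
have [rho hrho] := flow_bounded r T.
have [K hK] := solution_lipschitz 1 rho.
exists (d%:R * expR (`|K| * `|T|)) => [|v w t hv hw /andP[t0 tT]].
  by rewrite mulr_ge0 ?expR_ge0.
apply: le_trans (norm1_le_norm2 _) _; rewrite -mulrA ler_wpM2l//.
apply: (@le_trans _ _ (expR (`|K| * `|T|) * norm2 (v - w))); last first.
  by rewrite ler_wpM2l ?expR_ge0 ?norm2_le_norm1.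
rewrite -(@ler_pXn2r _ 2) ?nnegrE ?mulr_ge0 ?norm2_ge0 ?expR_ge0// exprMn.
have hsol x : solution 1 (fun s => Psi s x).
  by have := solution_flow 1 0 x; congr solution; apply/funext => s;
    rewrite addr0 mul1r.
have := hK _ _ t (hsol v) (hsol w) t0; rewrite !flow0// => /(_ _)/le_trans; apply.
  move=> s /andP[s0 st]; have sT : 0 <= s <= T by rewrite s0 (le_trans st).
  by rewrite !hrho.
rewrite ler_wpM2r ?sqr_ge0//.
apply: (@le_trans _ _ (expR (`|K| * `|T|))); last first.
  rewrite expr2 ler_peMr ?expR_ge0//.
  by rewrite -[leLHS]expR0 ler_expR mulr_ge0.
rewrite ler_expR; apply: le_trans (ler_norm _) _; rewrite normrM.
by rewrite ler_wpM2l// ger0_norm// (le_trans tT)// ler_norm.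
Qed.

End lorenz96_flow.

(** * From derivatives to sampled observations *)

Section finite_differences.
Context {R : realType}.
Variables (h : R) (h_gt0 : 0 < h).

Fixpoint fdiff (i : nat) (w : R -> R) : R -> R :=
  if i is i'.+1 then fdiff i' (fun t => w (t + h) - w t) else w.

(** One mean value theorem per difference: the difference of order i + 1 of W 0 is
    that of order i of the increment t |-> W 0 (t + h) - W 0 t. *)
Lemma fdiff_mean_value (W : nat -> R -> R) :
  (forall i (t : R), is_derive t (1 : R) (W i) (W i.+1 t)) ->
  forall i t, exists2 xi, t <= xi <= t + i%:R * h & fdiff i (W 0) t = h ^+ i * W i xi.
Proof.
move=> hW i t; elim: i W hW => [|i IH] W hW.
  by exists t; rewrite ?mul0r ?addr0 ?lexx ?mul1r.
pose V i t := W i (t + h) - W i t.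
have [xi /andP[txi xit] E] : exists2 xi, t <= xi <= t + i%:R * h &
    fdiff i (V 0%N) t = h ^+ i * V i xi.
  apply: IH => k s.
  have hs : is_derive s (1 : R) (fun t => W k (t + h)) (W k.+1 (s + h)).
    have := @is_derive_comp_affine R (W k) 1 h s (W k.+1 (s + h)).
    rewrite !mul1r (_ : (fun s => _) = fun s => W k (s + h)).
      by apply; exact: hW.
    by apply/funext => x; rewrite mul1r.
  exact: (is_deriveB hs (hW k s)).
have [c /andP[xic cxi] E'] := is_derive_MVT (ltW (ltr_pwDr h_gt0 (lexx xi))) (hW i).
exists c.
  rewrite (le_trans txi xic) (le_trans cxi)// -natr1 mulrDl mul1r addrA.
  by rewrite lerD2r.
rewrite [LHS]E /V E' addrAC subrr add0r exprSr; ring.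
Qed.

Lemma fdiff_le i (w : R -> R) t :
  `|fdiff i w t| <= 2 ^+ i * \sum_(a < i.+1) `|w (t + a%:R * h)|.
Proof.
elim: i w => [|i IH] w; first by rewrite big_ord1 mul0r addr0 mul1r.
apply: le_trans (IH _) _; rewrite exprSr -mulrA ler_wpM2l ?exprn_ge0//.
apply: (@le_trans _ _ (\sum_(a < i.+1) `|w (t + a.+1%:R * h)|
                       + \sum_(a < i.+1) `|w (t + a%:R * h)|)).
  rewrite -big_split; apply: ler_sum => a _ /=.
  rewrite (_ : t + a%:R * h + h = t + a.+1%:R * h); first exact: ler_normB.
  by rewrite -natr1; ring.
rewrite mulr_natl mulr2n; apply: lerD.
  by rewrite [leRHS]big_ord_recl /= lerDr.
by rewrite [leRHS]big_ord_recr /= lerDl.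
Qed.

End finite_differences.

Section observability.
Context {R : realType} {d : nat}.
Variables (Psi : R -> 'rV[R]_d -> 'rV[R]_d) (hPsi : is_flow lorenz96 Psi).
Variables (r : R) (j : nat) (hj : (d - 3 <= j)%N).

Definition sampling_gap (h : R) (v u : 'rV[R]_d) : R :=
  \sum_(i < j.+1) \sum_(m < d | (m < 3)%N)
    `|Psi (i%:R * h) v ord0 m - Psi (i%:R * h) u ord0 m|.

(** Since every derivative along the flow is a polynomial of the current state, the
    Lipschitz dependence of the state on the initial point passes to all derivatives
    without differentiating the flow in space. *)
Lemma derivatives_lipschitz (T : R) : exists2 B : R, 0 <= B &
  forall (i : nat) (m : 'I_d) v w t, (i <= j.+1)%N -> Ball r v -> Ball r w ->
    0 <= t <= T ->
    `|peval (iter i lie (PVar m)) (Psi t v) - peval (iter i lie (PVar m)) (Psi t w)|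
      <= B * norm1 (v - w).
Proof.
have [rho hrho] := flow_bounded hPsi r T.
have [K K0 hK] := flow_lipschitz hPsi r T.
have hL (i : nat) (m : 'I_d) := peval_lipschitz rho (iter i lie (@PVar R _ m)).
pose L i m := sval (cid2 (hL i m)).
have L0 i m : 0 <= L i m by rewrite /L; case: cid2.
exists ((\sum_(i < j.+2) \sum_m L i m) * K) => [|i m v w t ij hv hw tT].
  by rewrite mulr_ge0// sumr_ge0// => i _; exact: sumr_ge0.
apply: (@le_trans _ _ (L i m * norm1 (Psi t v - Psi t w))).
  by rewrite /L; case: cid2 => l l0 hl /=; apply: hl; exact: hrho.
rewrite -mulrA; apply: ler_pM => //; rewrite ?norm1_ge0 ?hK//.
rewrite (bigD1 (Ordinal (ij : (i < j.+2)%N)))//= (bigD1 m)//= -addrA lerDl.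
by rewrite addr_ge0 ?sumr_ge0// => a _; exact: sumr_ge0.
Qed.

(** Derivatives at 0 are compared with finite differences of the observed
    coordinates of two trajectories. The i-th difference divided by h^i is the i-th
    derivative at some xi in [0, ih], whose distance to the derivative at 0 is
    at most ih times the next derivative, itself of the order of norm1 (v - u). *)
Lemma jet_gap_le_sampling_gap : exists2 B : R, 0 <= B &
  forall h : R, 0 < h <= 1 -> exists2 A : R, 0 <= A &
  forall v u, Ball r v -> Ball r u ->
    jet_gap j v u <= A * sampling_gap h v u + B * h * norm1 (v - u).
Proof.
have [B B0 hB] := derivatives_lipschitz j%:R.
pose N : R := \sum_(i < j.+1) \sum_(m < d | (m < 3)%N) 1.
have N0 : 0 <= N by apply: sumr_ge0 => i _; exact: sumr_ge0.
exists (N * (B * j%:R)) => [|h /andP[h0 h1]]; first by rewrite !mulr_ge0.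
pose A : R := \sum_(i < j.+1) 2 ^+ i * h ^- i.
have A0 : 0 <= A.
  by apply: sumr_ge0 => i _; rewrite mulr_ge0 ?invr_ge0 ?exprn_ge0 ?(ltW h0).
exists (N * A) => [|v u hv hu]; first by rewrite mulr_ge0.
rewrite -!mulrA -mulrDr /N mulr_suml; apply: ler_sum => i _.
rewrite mulr_suml; apply: ler_sum => m m3; rewrite mul1r.
(* the k-th time derivative of the difference of the two trajectories *)
pose W k s := peval (iter k lie (PVar m)) (Psi s v)
            - peval (iter k lie (PVar m)) (Psi s u).
have hW k (t : R) : is_derive t (1 : R) (W k) (W k.+1 t).
  exact: (is_deriveB (is_derive_peval_flow hPsi _ v t) (is_derive_peval_flow hPsi _ u t)).
have [xi /andP[xi0 xih] E] := fdiff_mean_value h0 hW i 0.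
have [c /andP[c0 cxi] E'] := is_derive_MVT xi0 (hW i).
have ij : (i <= j)%N by rewrite -ltnS.
have ihj : i%:R * h <= j%:R :> R by rewrite -[leRHS]mulr1 ler_pM ?ler_nat// (ltW h0).
have -> : peval (iter i lie (PVar m)) v - peval (iter i lie (PVar m)) u = W i 0.
  by rewrite /W !flow0.
rewrite -(subrK (W i xi) (W i 0)) addrC; apply: le_trans (ler_normD _ _) _.
apply: lerD.
  have -> : W i xi = h ^- i * fdiff h i (W 0%N) 0.
    by rewrite E mulKf// expf_neq0// gt_eqF.
  rewrite normrM ger0_norm ?invr_ge0 ?exprn_ge0 ?(ltW h0)//.
  apply: (@le_trans _ _ (h ^- i * (2 ^+ i * sampling_gap h v u))).
    rewrite ler_wpM2l ?invr_ge0 ?exprn_ge0 ?(ltW h0)//.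
    apply: le_trans (fdiff_le _ _ _ _) _; rewrite ler_wpM2l ?exprn_ge0//.
    apply: (@le_trans _ _ (\sum_(a < i.+1) \sum_(m < d | (m < 3)%N)
      `|Psi (a%:R * h) v ord0 m - Psi (a%:R * h) u ord0 m|)).
      apply: ler_sum => a _; rewrite add0r (bigD1 m)//= lerDl.
      exact: sumr_ge0.
    rewrite /sampling_gap -!(big_mkord xpredT (fun a => \sum_(m < d | (m < 3)%N)
      `|Psi (a%:R * h) v ord0 m - Psi (a%:R * h) u ord0 m|)).
    rewrite [leRHS](big_cat_nat _ (n := i.+1))//= lerDl.
    by apply: sumr_ge0 => a _; exact: sumr_ge0.
  rewrite mulrA ler_wpM2r//.
    by apply: sumr_ge0 => a _; exact: sumr_ge0.
  rewrite mulrC /A (bigD1 i)//= lerDl.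
  by apply: sumr_ge0 => a _; rewrite mulr_ge0 ?invr_ge0 ?exprn_ge0 ?(ltW h0).
rewrite distrC E' subr0 normrM [`|xi|]ger0_norm// mulrC.
rewrite [leRHS](_ : _ = (j%:R * h) * (B * norm1 (v - u))); last by ring.
rewrite ler_pM//.
  apply: le_trans xih _; rewrite add0r ler_wpM2r ?(ltW h0)// ler_nat//.
apply: hB => //; rewrite c0 (le_trans cxi)// (le_trans xih)// add0r//.
Qed.

(** In the bound norm1 (v - u) <= C (A gap + B h norm1 (v - u)), the last term is
    absorbed by the left-hand side as soon as 2 C B h <= 1. *)
Lemma sampling_stability (u : 'rV[R]_d) : Ball r u -> (forall m, u ord0 m != 0) ->
  exists2 h0 : R, 0 < h0 & forall h : R, 0 < h <= h0 ->
    exists2 C : R, 0 <= C &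
    forall v, Ball r v -> norm1 (v - u) <= C * sampling_gap h v u.
Proof.
move=> hu u0; have [C C0 hC] := jet_stability r hj u0.
have [B B0 hB] := jet_gap_le_sampling_gap.
have D0 : 0 < 1 + 2 * (C * B) by rewrite ltr_wpDr// !mulr_ge0// (ltW C0).
exists (1 + 2 * (C * B))^-1 => [|h /andP[h0 hh]]; first by rewrite invr_gt0.
have h1 : h <= 1.
  by rewrite (le_trans hh)// invf_le1// lerDl !mulr_ge0// (ltW C0).
have [|A A0 hA] := hB h; first by rewrite h0.
exists (2 * (C * A)) => [|v hv]; first by rewrite !mulr_ge0// (ltW C0).
have := hC v hv; have := ler_wpM2l (ltW C0) (hA v u hv hu).
have hCB : 2 * (C * B * h) <= 1.
  have : (1 + 2 * (C * B)) * h <= 1 by rewrite mulrC -ler_pdivlMr// div1r.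
  by apply: le_trans; rewrite [leRHS]mulrDl mul1r mulrA lerDr (ltW h0).
have n0 := norm1_ge0 (v - u).
have : 2 * (C * B * h) * norm1 (v - u) <= norm1 (v - u) by rewrite ler_piMl.
move: (jet_gap _ _ _) (sampling_gap _ _ _) (norm1 _) => g s n; nra.
Qed.

End observability.

(** * Jets at the initial point: injectivity and rank *)

Lemma Ball_interior (R : realType) n (r : R) (u : 'rV[R]_n) : norm2 u < r ->
  exists2 delta : R, 0 < delta & forall v, norm1 (v - u) <= delta -> Ball r v.
Proof.
move=> ur; have r0 : 0 < r := le_lt_trans (norm2_ge0 u) ur.
have g0 : 0 < r ^+ 2 - norm2 u ^+ 2.
  by rewrite subr_gt0 ltr_pXn2r ?nnegrE ?norm2_ge0 ?(ltW r0).
have p0 : 0 < 1 + 2 * r by rewrite addr_gt0 ?mulr_gt0.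
(* for norm1 (v - u) <= delta <= 1, the squared norms of v and u differ by at
   most delta (1 + 2 r) *)
exists (Num.min 1 ((r ^+ 2 - norm2 u ^+ 2) / (1 + 2 * r))) => [|v].
  by rewrite lt_min ltr01 divr_gt0.
rewrite le_min => /andP[n1]; rewrite ler_pdivlMr// => hn.
rewrite /Ball /= norm2_le_sqrP ?(ltW r0)//.
have -> : dotv v v = dotv u u + (dotv (v - u) (v - u) + 2 * dotv u (v - u)).
  rewrite /dotv mulr_sumr -!big_split; apply: eq_bigr => i _ /=.
  by rewrite !mxE; ring.
rewrite -lerBrDl -[in leRHS]sqr_norm2; apply: le_trans hn.
rewrite mulrDr mulr1; apply: lerD.
  rewrite -sqr_norm2 (@le_trans _ _ (norm1 (v - u) ^+ 2))//.
    by rewrite ler_pXn2r ?nnegrE ?norm2_ge0 ?norm1_ge0 ?norm2_le_norm1.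
  by rewrite expr2 ler_piMr ?norm1_ge0.
rewrite mulrCA ler_wpM2l// mulrC /norm1 mulr_sumr; apply: ler_sum => i _.
apply: le_trans (ler_norm _) _; rewrite normrM ler_wpM2r//.
by apply: le_trans (ler_coord_norm2 _ _) _; exact: ltW.
Qed.

(** The vectors are the rows of a matrix; if nothing but 0 is orthogonal to all of
    them, the transpose has trivial kernel and the matrix has full rank. *)
Lemma span_fullv (R : realType) n (X : seq 'rV[R]_n) :
  (forall x, (forall g, g \in X -> dotv g x = 0) -> x = 0) ->
  <<X>>%VS = fullv.
Proof.
move=> h; pose A : 'M[R]_(size X, n) := \matrix_(i, k) (X`_i) ord0 k.
have rowA i : row i A = X`_i by apply/rowP => k; rewrite !mxE.
have Afull : row_full A.
  rewrite /row_full -mxrank_tr; apply: inj_row_free => x xA.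
  apply: h => g /(nthP 0)[i iX <-].
  have := congr1 (fun y : 'rV[R]__ => y ord0 (Ordinal iX)) xA.
  rewrite !mxE => <-; apply: eq_bigr => k _.
  by rewrite !mxE mulrC.
apply/eqP; rewrite eqEsubv subvf /=; apply/subvP => v _.
have /submxP[y ->] : (v <= A)%MS by apply: submx_full.
rewrite mulmx_sum_row; apply: memv_suml => i _; apply: memvZ.
by rewrite rowA; apply: memv_span; exact: mem_nth.
Qed.

Lemma dotv_gradient (R : realType) n (f : 'rV[R]_n -> R) u x :
  differentiable f u -> dotv (gradient f u) x = 'D_x f u.
Proof.
move=> df; rewrite deriveE// {2}(row_sum_delta x) linear_sum.
by apply: eq_bigr => m _; rewrite linearZ mxE deriveE// mulrC.
Qed.

Lemma obs_coord (R : realType) d dobs (v : 'rV[R]_d) (l : 'I_dobs) (m : 'I_d) :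
  l = m :> nat -> (m < 3)%N -> obs v ord0 l = v ord0 m.
Proof.
move=> lm m3; rewrite /obs mxE (bigD1 m)//= big1 => [|k km].
  by rewrite !mxE lm eqxx m3 mulr1 addr0.
rewrite !mxE lm (_ : (m : nat) == k = false) ?mulr0//.
by apply: contra_neqF km => /eqP/val_inj.
Qed.

Lemma cvg_sum0 (R : realType) (F : set_system R) (FF : Filter F) (I : finType)
    (P : pred I) (f : I -> R -> R) :
  (forall i, P i -> f i s @[s --> F] --> (0 : R)) ->
  \sum_(i | P i) f i s @[s --> F] --> (0 : R).
Proof.
move=> hf; elim: (index_enum I) => [|i e IH].
  rewrite (_ : (fun _ => _) = cst 0); first exact: cvg_cst.
  by apply/funext => s; rewrite big_nil.
case Pi : (P i); last first.
  by rewrite (_ : (fun _ => _) = fun s => \sum_(i <- e | P i) f i s)//;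
    apply/funext => s; rewrite big_cons Pi.
rewrite (_ : (fun _ => _) = fun s => f i s + \sum_(i <- e | P i) f i s).
  by rewrite -[X in _ --> X]addr0; exact: cvgD (hf i Pi) IH.
by apply/funext => s; rewrite big_cons Pi.
Qed.

Section initial_jets.
Context {R : realType} {d dobs : nat}.
Hypothesis (hdobs : (3 <= dobs)%N).
Variables (Psi : R -> 'rV[R]_d -> 'rV[R]_d) (hPsi : is_flow lorenz96 Psi).
Variables (r : R) (j : nat) (hj : (d - 3 <= j)%N).
Variables (u : 'rV[R]_d) (hu : norm2 u < r) (u0 : forall m, u ord0 m != 0).
Let H : 'rV[R]_d -> 'rV[R]_dobs := obs.
Let D := time_derivative Psi.

Lemma obs_time_derivative i w (m : 'I_d) (m3 : (m < 3)%N) :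
  H (D i w) ord0 (widen_ord hdobs (Ordinal m3)) = peval (iter i lie (PVar m)) w.
Proof. by rewrite /H (@obs_coord _ _ _ _ _ m)// /D time_derivativeE. Qed.

Lemma initial_jet_injective v : Ball r v ->
  (forall i, (i <= j)%N -> H (D i u) = H (D i v)) <-> v = u.
Proof.
move=> hv; split=> [E|->//].
have [C _ /(_ v hv)] := jet_stability r hj u0.
rewrite /jet_gap big1 ?mulr0 => [|i _]; last first.
  rewrite big1// => m m3; rewrite -!(obs_time_derivative _ _ m3) E ?subrr ?normr0//.
  by rewrite -ltnS.
move=> n0; apply/eqP; rewrite -subr_eq0; apply/eqP/rowP => m; rewrite [RHS]mxE.
by apply/eqP; rewrite -normr_le0; apply: le_trans n0; exact: ler_coord_norm1.
Qed.

(** If x is orthogonal to all gradients, the observed jets at u + s x and at u differ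
    by o(s), whereas jet_stability makes this difference at least of the order of
    |s| norm1 x. Hence x = 0. *)
Lemma initial_gradients_span :
  <<[seq gradient (fun w => H (D i w) ord0 l) u | i <- iota 0 j.+1, l <- enum 'I_dobs]>>%VS
  = fullv.
Proof.
apply: span_fullv => x hx.
have dx0 i (m : 'I_d) : (i < j.+1)%N -> (m < 3)%N ->
    'D_x (peval (iter i lie (PVar m))) u = 0.
  move=> ij m3; rewrite -dotv_gradient; last exact: differentiable_peval.
  have ij' : i \in iota 0 j.+1 by rewrite mem_iota.
  apply: hx; apply/allpairsP.
  exists (i, widen_ord hdobs (Ordinal m3)); split; first exact: ij'.
    by rewrite mem_enum.
  by congr gradient; apply/funext => w; rewrite obs_time_derivative.
pose q i (m : 'I_d) (s : R) := s^-1 *: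
  (peval (iter i lie (PVar m)) (s *: x + u) - peval (iter i lie (PVar m)) u).
have q0 i (m : 'I_d) : (i < j.+1)%N -> (m < 3)%N -> q i m s @[s --> 0^'] --> (0 : R).
  move=> ij m3; rewrite -[X in _ --> X](dx0 i m ij m3).
  have dq : derivable (peval (iter i lie (PVar m))) u x.
    exact/diff_derivable/differentiable_peval.
  exact: dq.
have Q0 : \sum_(i < j.+1) \sum_(m < d | (m < 3)%N) `|q i m s| @[s --> 0^'] --> (0 : R).
  apply: cvg_sum0 => i _; apply: cvg_sum0 => m m3.
  by rewrite -[X in _ --> X](normr0 R); apply: cvg_norm; exact: (q0 i m (ltn_ord i) m3).
have [C C0 hC] := jet_stability r hj u0.
have [delta delta0 hdelta] := Ball_interior hu.
suff n0 : norm1 x <= 0.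
  apply/rowP => m; rewrite [RHS]mxE; apply/eqP; rewrite -normr_le0.
  by apply: le_trans n0; exact: ler_coord_norm1.
apply/ler_addgt0Pr => e e0; rewrite add0r.
have eC0 : 0 < e / C by rewrite divr_gt0.
have d'0 : 0 < delta / (1 + norm1 x).
  by rewrite divr_gt0// ltr_wpDr// norm1_ge0.
have [s [s0 sQ sd]] : exists s : R, [/\ s != 0,
    \sum_(i < j.+1) \sum_(m < d | (m < 3)%N) `|q i m s| <= e / C
    & `|s| <= delta / (1 + norm1 x)].
  apply: (@filter_ex _ (0^' : set_system R)).
  near=> s; split.
  - near: s; exact: nbhs_dnbhs_neq.
  - near: s; move/cvgrPdist_le : Q0 => /(_ _ eC0); apply: filterS => s.
    by rewrite sub0r normrN; apply: le_trans; exact: ler_norm.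
  - near: s; exact: dnbhs0_le.
have sx : norm1 (s *: x + u - u) = `|s| * norm1 x.
  rewrite addrK /norm1 mulr_sumr; apply: eq_bigr => i _.
  by rewrite !mxE normrM.
have hv : Ball r (s *: x + u).
  apply: hdelta; rewrite sx; apply: le_trans (ler_wpM2r (norm1_ge0 x) sd) _.
  rewrite -mulrA ler_piMr ?(ltW delta0)// mulrC ler_pdivrMr ?mul1r ?lerDr//.
  by rewrite ltr_wpDr// norm1_ge0.
have := hC _ hv; rewrite sx mulrC -ler_pdivlMr ?normr_gt0// => /le_trans; apply.
rewrite mulrAC -mulrA mulrC -ler_pdivlMr//; apply: le_trans sQ.
rewrite /jet_gap mulrC mulr_suml; apply: ler_sum => i _.
rewrite mulr_suml; apply: ler_sum => m m3.
by rewrite /q /GRing.scale /= normrM normfV mulrC.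
Unshelve. all: by end_near. Qed.

End initial_jets.

(** * Null sets of initial points *)

Section null_sets.
Context {R : realType}.

Lemma measurable_coordR n (i : 'I_n) :
  measurable_fun [set: 'rV[R]_n] (fun x : 'rV[R]_n => x ord0 i : R).
Proof. exact: (@measurable_coord _ (measurableTypeR R)). Qed.

Lemma measurable_dotvv n : measurable_fun [set: 'rV[R]_n] (fun x => dotv x x : R).
Proof.
apply: measurable_sum => i; apply: measurable_funM; exact: measurable_coordR.
Qed.

Lemma measurable_box n (a b : 'rV[R]_n) :
  measurable [set x : 'rV[R]_n | forall i, x ord0 i \in `[a ord0 i, b ord0 i]].
Proof.
rewrite (_ : [set x | _] = \bigcap_(i in [set: 'I_n])
   [set x : 'rV[R]_n | x ord0 i \in `[a ord0 i, b ord0 i]]).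
  apply: fin_bigcap_measurable => // i _.
  rewrite -[X in measurable X]setTI.
  by have := @measurable_coordR n i measurableT _
    (measurable_itv `[a ord0 i, b ord0 i]).
by apply/seteqP; split=> x /= h i; [move=> _|]; exact: h.
Qed.

(** A coordinate hyperplane is a countable union of boxes with one side of length 0. *)
Lemma ae_coord_neq0 n (m : 'I_n) :
  {ae lebesgue_rV n, forall u : 'rV[R]_n, u ord0 m != 0}.
Proof.
(* the box of half-side k, flattened in the direction m *)
pose b k : 'rV[R]_n := \row_i if i == m then 0 else k%:R.
pose box k := [set x : 'rV[R]_n | forall i, x ord0 i \in `[(- b k) ord0 i, b k ord0 i]].
have nbox k : (lebesgue_rV n).-negligible (box k).
  apply/negligibleP; first exact: measurable_box.
  apply: (etrans (@lebesgue_rV_box R n (- b k) (b k) _)) => [i|]; last first.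
    by rewrite (bigD1 m)//= !mxE eqxx oppr0 subrr mul0r.
  by rewrite !mxE; case: ifP => _; rewrite ?oppr0// lerNl (le_trans _ (ler0n _ _))// oppr_le0.
apply: negligibleS (negligible_bigcup nbox) => u /= /negP; rewrite negbK => /eqP um.
have [k hk] : exists k : nat, norm1 u <= k%:R.
  exists (Num.truncn (norm1 u)).+1; apply: ltW; apply: truncnS_gt.
exists k => // i; rewrite in_itv /= !mxE.
case: eqP => [->|_]; first by rewrite um oppr0 lexx.
by rewrite -ler_norml (le_trans _ hk)// ler_coord_norm1.
Qed.

Lemma dotv_rV_cons n (p : measurableTypeR R * 'rV[R]_n) :
  dotv (rV_cons p) (rV_cons p) = p.1 ^+ 2 + dotv p.2 p.2.
Proof.
have E0 : rV_cons p ord0 (lshift n (ord0 : 'I_1)) = p.1.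
  by apply: (etrans (row_mxEl _ _ _ _)); rewrite mxE eqxx.
have ES i : rV_cons p ord0 (rshift 1 i) = p.2 ord0 i by exact: row_mxEr.
rewrite /dotv (@big_split_ord _ _ _ 1%N n) big_ord1 E0 expr2; congr (_ + _).
by apply: eq_bigr => i _; rewrite ES.
Qed.

(** Fixing all coordinates but the first leaves at most two points of the sphere on
    each line, and Tonelli's theorem integrates these null sections. *)
Lemma ae_norm2_neq n (r : R) : (0 < n)%N ->
  {ae lebesgue_rV n, forall u : 'rV[R]_n, norm2 u != r}.
Proof.
case: n => // n _.
pose S := [set u : 'rV[R]_n.+1 | dotv u u = r ^+ 2].
have mS : measurable S.
  by rewrite -[X in measurable X]setTI; exact: (@measurable_dotvv _ measurableT [set r ^+ 2]).
pose A := @rV_cons R n @^-1` S.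
have AE p : A p = (p.1 ^+ 2 + dotv p.2 p.2 = r ^+ 2).
  by rewrite /A /= /S /= dotv_rV_cons.
have mA : measurable A.
  rewrite (_ : A = setT `&` (fun p : measurableTypeR R * 'rV[R]_n =>
      (p.1 : R) ^+ 2 + dotv p.2 p.2) @^-1` [set r ^+ 2]).
    apply: measurable_funD => //.
      exact: (measurable_funX 2 (measurable_fst : measurable_fun setT (fst : _ -> measurableTypeR R))).
    exact: (measurableT_comp (@measurable_dotvv n) measurable_snd).
  by rewrite setTI; apply/funext => p; rewrite AE.
apply: (@negligibleS _ _ _ _ S) => [u /= /negP|].
  by rewrite negbK => /eqP ur; rewrite /S /= -ur sqr_norm2.
apply/negligibleP => //.
transitivity ((@lebesgue_measure R \x^ lebesgue_rV n)%E A).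
  apply: product_measure_unique => //= ? ? ? ?; rewrite product_measure2E//.
rewrite /product_measure2 /=; apply: integral0_eq => v _ /=.
pose s := Num.sqrt (r ^+ 2 - dotv v v).
apply: (@subset_measure0 _ _ _ _ _ ([set s] `|` [set - s] : set (measurableTypeR R))).
- exact: measurable_ysection.
- by apply: measurableU; exact: measurable_set1.
- move=> x; rewrite /ysection /= inE AE /= => xE.
  have /eqP : (x : R) ^+ 2 = s ^+ 2 by rewrite /s sqr_sqrtr -xE addrK ?sqr_ge0.
  by rewrite eqf_sqr => /orP[] /eqP ->; [left|right].
- apply: countable_lebesgue_measure0; apply: finite_set_countable.
  by rewrite finite_setU; split; exact: finite_set1.
Qed.

End null_sets.

(** * Estimators by minimization over a dense sequence *)

Section best_candidate.
Context {disp : measure_display} {T : measurableType disp} {R : realType}.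
Variables (cost : nat -> T -> R).
Hypothesis mcost : forall n, measurable_fun setT (cost n).

(** A minimization over finitely many candidates is measurable in the data y, whereas
    a minimizer over a continuum would have to be selected measurably. *)
Fixpoint best (m : nat) (y : T) : nat :=
  if m is m'.+1 then
    if cost m y < cost (best m' y) y then m else best m' y
  else 0.

Lemma best_le m n y : (n <= m)%N -> cost (best m y) y <= cost n y.
Proof.
elim: m => [|m IH]; first by rewrite leqn0 => /eqP ->.
rewrite leq_eqVlt ltnS => /orP[/eqP ->|/IH nm] /=; case: ltP => //.
by move=> /ltW h; exact: le_trans h _.
Qed.

Lemma measurable_best_cost m : measurable_fun setT (fun y => cost (best m y) y).
Proof.
elim: m => [|m IH] /=; first exact: mcost.
rewrite (_ : (fun _ => _) = fun y => if cost m.+1 y < cost (best m y) y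
  then cost m.+1 y else cost (best m y) y).
  by apply: measurable_fun_ifT => //; exact: measurable_fun_ltr.
by apply/funext => y; case: ifP.
Qed.

Lemma measurable_best (g : nat -> R) m : measurable_fun setT (fun y => g (best m y)).
Proof.
elim: m => [|m IH] /=; first exact: measurable_cst.
rewrite (_ : (fun _ => _) = fun y => if cost m.+1 y < cost (best m y) y
  then g m.+1 else g (best m y)).
  apply: measurable_fun_ifT => //; apply: measurable_fun_ltr => //.
  exact: measurable_best_cost.
by apply/funext => y; case: ifP.
Qed.

(** The cheapest candidates need not converge, but their coordinatewise upper limit
    always makes sense, is measurable, and inherits every bound that they satisfy
    eventually. *)
Definition estimator d (G : nat -> 'rV[R]_d) (y : T) : 'rV[R]_d :=
  \row_l fine (limn_esup (fun m => (G (best m y) ord0 l)%:E)).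

Lemma measurable_estimator d (G : nat -> 'rV[R]_d) :
  measurable_fun setT (estimator G).
Proof.
apply: (@measurable_fun_coord _ (measurableTypeR R)) => l.
rewrite (_ : (fun _ => _) =
  fine \o (fun y => limn_esup (fun m => (G (best m y) ord0 l)%:E))); last first.
  by apply/funext => y; rewrite mxE.
apply: measurableT_comp; first exact: fine_measurable.
apply: (@measurable_fun_limn_esup _ _ _ setT
  (fun m y => (G (best m y) ord0 l)%:E)) => m.
by apply/measurable_EFinP; exact: (measurable_best (fun n => G n ord0 l)).
Qed.

Lemma limn_esup_approx (x : nat -> R) (a B : R) :
  (forall e : R, 0 < e -> exists N : nat, forall m : nat, (N <= m)%N -> `|x m - a| <= B + e) ->
  `|fine (limn_esup (fun m => (x m)%:E)) - a| <= B.
Proof.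
move=> h; pose L := limn_esup (fun m => (x m)%:E).
have hL (e : R) : 0 < e -> ((a - B - e)%:E <= L <= (a + B + e)%:E)%E.
  move=> e0; have [N hN] := h e e0.
  have hx m : (N <= m)%N -> a - B - e <= x m <= a + B + e.
    by move=> /hN; rewrite ler_norml => /andP[? ?]; apply/andP; split; lra.
  rewrite /L limn_esup_lim; apply/andP; split.
    apply: lime_ge; first exact: is_cvg_esups.
    near=> m; apply: (@le_trans _ _ (x m)%:E).
      rewrite lee_fin; have /hx/andP[] // : (N <= m)%N.
      by near: m; exists N.
    by apply: ereal_sup_ubound; exists m => /=.
  apply: lime_le; first exact: is_cvg_esups.
  near=> m; apply: ub_ereal_sup => _ [p /= mp <-]; rewrite lee_fin.
  have Nm : (N <= m)%N by near: m; exists N.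
  by have /andP[] := hx p (leq_trans Nm mp).
have Lfin : L \is a fin_num.
  have /andP[lo hi] := hL 1 ltr01.
  rewrite fin_numE; apply/andP; split; apply/eqP => E; first by rewrite E in lo.
  by rewrite E in hi.
apply/ler_addgt0Pr => e e0; have := hL e e0.
rewrite -/L -[in X in X -> _](fineK Lfin) !lee_fin ler_norml => /andP[? ?].
by apply/andP; split; lra.
Unshelve. all: by end_near. Qed.

Lemma estimator_approx d (G : nat -> 'rV[R]_d) y (v : 'rV[R]_d) (B : R) :
  (forall e : R, 0 < e -> exists N : nat, forall m : nat, (N <= m)%N ->
     norm1 (G (best m y) - v) <= B + e) ->
  norm1 (estimator G y - v) <= d%:R * B.
Proof.
move=> h; rewrite mulr_natl -[X in _ *+ X]card_ord -[leRHS]sumr_const.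
apply: ler_sum => l _; rewrite !mxE.
apply: (limn_esup_approx (x := fun m => G (best m y) ord0 l)) => e e0.
have [N hN] := h e e0; exists N => m /hN; apply: le_trans.
by have := ler_coord_norm1 (G (best m y) - v) l; rewrite !mxE.
Qed.

End best_candidate.

Section rational_points.
Context {R : realType} {d : nat}.
Variable (r : R).

(** A dense sequence in the ball, obtained by enumerating the rational vectors and
    sending those outside the ball to 0. *)
Definition rational_point (n : nat) : 'rV[R]_d :=
  let q : 'rV[rat]_d := odflt 0 (unpickle n) in
  let v := map_mx ratr q in if norm2 v <= r then v else 0.

Lemma rational_point_Ball n : 0 <= r -> Ball r (rational_point n).
Proof.
move=> r0; rewrite /rational_point /Ball /=; case: ifP => // _.
by rewrite /norm2 /dotv big1 ?sqrtr0// => i _; rewrite mxE mul0r.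
Qed.

Lemma rational_point_dense (u : 'rV[R]_d) (e : R) : norm2 u < r -> 0 < e ->
  exists n, norm1 (rational_point n - u) <= e.
Proof.
move=> ur e0; have [delta delta0 hdelta] := Ball_interior ur.
pose a := Num.min e delta / d.+1%:R.
have a0 : 0 < a by rewrite divr_gt0// lt_min e0.
have ha i : exists q : rat, ratr q \in `]u ord0 i - a, u ord0 i + a[.
  by apply: rat_in_itvoo; rewrite ltrD2l gtrN.
pose q : 'rV[rat]_d := \row_i sval (cid (ha i)).
have hq : norm1 (map_mx ratr q - u) <= Num.min e delta.
  apply: (@le_trans _ _ (d%:R * a)).
    rewrite mulr_natl -[X in _ *+ X]card_ord -[leRHS]sumr_const.
    apply: ler_sum => i _; rewrite !mxE; case: cid => x /=.
    by rewrite in_itv /= -ltr_distl => /ltW.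
  rewrite /a mulrCA ler_piMr ?ler_pdivrMr ?mul1r ?ler_nat//.
  by rewrite le_min (ltW e0) (ltW delta0).
move: hq; rewrite le_min => /andP[qe qd].
exists (pickle q); rewrite /rational_point pickleK /=.
by rewrite (hdelta _ qd : norm2 _ <= r).
Qed.

End rational_points.

(** * Supports under bounded errors *)

(** The exceptional initial points of all parts of the result lie on the sphere or on
    a coordinate hyperplane. *)
Lemma ae_generic (R : realType) d (r : R) : (0 < d)%N ->
  {ae lebesgue_rV d, forall u : 'rV[R]_d, norm2 u != r /\ forall m, u ord0 m != 0}.
Proof.
move=> d0; apply: filterI; first exact: ae_norm2_neq.
exact: (@filter_forall _ _ (fun (m : 'I_d) (u : 'rV[R]_d) => u ord0 m != 0)
  (almost_everywhere (lebesgue_rV d)) _ (fun m => ae_coord_neq0 m)).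
Qed.

Lemma diameter_le (R : realType) d (A : set 'rV[R]_d) (c : 'rV[R]_d) (B : R) :
  (forall v, A v -> norm1 (v - c) <= B) -> (diameter A <= (2 * B)%:E)%E.
Proof.
move=> hA; apply: ub_ereal_sup => _ [[v w] [/= Av Aw] <-]; rewrite lee_fin.
apply: le_trans (norm2_le_norm1 _) _.
apply: le_trans (norm1_dist_triangle c _ _) _.
by rewrite mulr_natl mulr2n lerD ?hA// norm1_distC hA.
Qed.

Section observation_operator.
Context {R : realType} {d dobs : nat}.
Implicit Types x y : 'rV[R]_d.

Lemma obsB x y : obs x - obs y = obs (x - y) :> 'rV[R]_dobs.
Proof. by rewrite /obs mulmxBl. Qed.

Lemma norm1_obs x : norm1 (obs x : 'rV[R]_dobs) <= dobs%:R * norm1 x.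
Proof.
rewrite mulr_natl -[X in _ *+ X]card_ord -[leRHS]sumr_const.
apply: ler_sum => l _; rewrite /obs mxE; apply: le_trans (ler_norm_sum _ _ _) _.
apply: ler_sum => k _; rewrite normrM ler_piMr// !mxE.
by case: (_ && _); rewrite ?normr1 ?normr0.
Qed.

Lemma norm1_observed x : (3 <= dobs)%N ->
  \sum_(m < d | (m < 3)%N) `|x ord0 m| <= d%:R * norm1 (obs x : 'rV[R]_dobs).
Proof.
move=> hdobs; rewrite mulr_natl -[X in _ *+ X]card_ord -[leRHS]sumr_const.
rewrite [leRHS](bigID (fun m : 'I_d => (m < 3)%N)) /=.
apply: ler_wpDr; first by apply: sumr_ge0 => m _; exact: norm1_ge0.
apply: ler_sum => m m3.
rewrite -(@obs_coord _ _ _ x (widen_ord hdobs (Ordinal m3)) m)//.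
exact: ler_coord_norm1.
Qed.

End observation_operator.

Section accuracy.
Context {R : realType} {d dobs : nat}.
Hypothesis (hdobs : (3 <= dobs)%N).
Variables (Psi : R -> 'rV[R]_d -> 'rV[R]_d) (hPsi : is_flow lorenz96 Psi).
Variables (r : R) (j : nat) (hj : (d - 3 <= j)%N).
Let H : 'rV[R]_d -> 'rV[R]_dobs := obs.

Definition obs_gap (h : R) (k : nat) (v u : 'rV[R]_d) : R :=
  \sum_(i < k.+1) norm1 (H (Psi (i%:R * h) v) - H (Psi (i%:R * h) u)).

(** Observation times beyond the j-th one only enlarge the gap. *)
Lemma obs_stability (u : 'rV[R]_d) : Ball r u -> (forall m, u ord0 m != 0) ->
  exists2 h0 : R, 0 < h0 & forall h : R, 0 < h <= h0 ->
    forall k : nat, (j <= k)%N -> exists2 C : R, 0 <= C &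
    forall v, Ball r v -> norm1 (v - u) <= C * obs_gap h k v u.
Proof.
move=> hu u0; have [h0 h00 hh0] := sampling_stability hPsi hj hu u0.
exists h0 => // h hh k jk; have [C C0 hC] := hh0 h hh.
exists (C * d%:R) => [|v hv]; first by rewrite mulr_ge0.
apply: le_trans (hC v hv) _; rewrite -mulrA ler_wpM2l// mulr_sumr.
rewrite -(big_mkord xpredT (fun i => d%:R *
  norm1 (H (Psi (i%:R * h) v) - H (Psi (i%:R * h) u)))).
rewrite (big_cat_nat _ (n := j.+1))//= ler_wpDr//.
  by apply: sumr_ge0 => i _; rewrite mulr_ge0 ?norm1_ge0.
rewrite big_mkord; apply: ler_sum => i _; rewrite /H obsB.
apply: le_trans (norm1_observed _ hdobs); apply: ler_sum => m _.
by rewrite !mxE.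
Qed.

Section consistent_states.
Variables (h : R) (k : nat) (u : 'rV[R]_d) (C K eps : R).
Hypotheses (C0 : 0 <= C) (K0 : 0 <= K).
Hypothesis hC : forall v, Ball r v -> norm1 (v - u) <= C * obs_gap h k v u.
Hypothesis hK : forall v, Ball r v ->
  norm1 (Psi (k%:R * h) v - Psi (k%:R * h) u) <= K * norm1 (v - u).
Variable z : nat -> 'rV[R]_dobs.
Hypothesis hz : forall i, norm2 (z i) <= eps.
Let y := observations Psi h u k z.

(** If both u and v explain the data with errors of size eps, then their noiseless
    observations differ by at most 2 eps. *)
Lemma consistent_near v : Ball r v ->
  (forall i : 'I_k.+1, norm2 (tnth y i - H (Psi (i%:R * h) v)) <= eps) ->
  norm1 (v - u) <= C * (k.+1%:R * (2 * dobs%:R * eps)).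
Proof.
move=> hv hy; apply: le_trans (hC hv) _; rewrite ler_wpM2l//.
rewrite mulr_natl -[X in _ *+ X]card_ord -[leRHS]sumr_const; apply: ler_sum => i _.
apply: le_trans (norm1_dist_triangle (tnth y i) _ _) _.
rewrite (_ : 2 * dobs%:R * eps = dobs%:R * eps + dobs%:R * eps); last by ring.
apply: lerD.
  rewrite norm1_distC; apply: le_trans (norm1_le_norm2 _) _.
  by rewrite ler_wpM2l.
rewrite tnth_mktuple addrAC subrr add0r.
by apply: le_trans (norm1_le_norm2 _) _; rewrite ler_wpM2l.
Qed.

Variables (q : 'rV[R]_d -> R) (eta : 'rV[R]_dobs -> R).
Hypothesis eta0 : forall x, eps < norm2 x -> eta x = 0.

Lemma eta_prod_neq0 (x : 'I_k.+1 -> 'rV[R]_dobs) :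
  \prod_(i < k.+1) eta (x i) != 0 -> forall i, norm2 (x i) <= eps.
Proof.
move=> /prodf_neq0 h0 i; have := h0 i isT.
by apply: contra_neqT; rewrite -ltNge; exact: eta0.
Qed.

Lemma smoother_diameter mu : is_smoother Psi r q eta h y mu ->
  (diameter (density_support mu) <=
    (2 * (C * (k.+1%:R * (2 * dobs%:R * eps))))%:E)%E.
Proof.
move=> [_ [c c0 muE]]; apply: (@diameter_le _ _ _ u) => v.
rewrite /density_support /= muE mulf_eq0 negb_or => /andP[_].
rewrite /smoother_weight; case: ifPn => [|_]; last by rewrite eqxx.
rewrite inE mulf_eq0 negb_or => hv /andP[_ /eta_prod_neq0 hx].
exact: consistent_near.
Qed.

(** A state in the support of the filter is the image at time kh of an initial point
    in the ball that explains the data, by the group property of the flow; the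
    Lipschitz constant of the flow at time kh transports the bound. *)
Lemma filter_diameter mu : is_filter Psi r q eta h y mu ->
  (diameter (density_support mu) <=
    (2 * (K * (C * (k.+1%:R * (2 * dobs%:R * eps)))))%:E)%E.
Proof.
move=> [_ [c c0 muE]]; apply: (@diameter_le _ _ _ (Psi (k%:R * h) u)) => v.
rewrite /density_support /= muE mulf_eq0 negb_or => /andP[_].
rewrite /filter_weight; case: ifPn => [|_]; last by rewrite eqxx.
rewrite inE => -[a ha <-]; rewrite !mulf_eq0 !negb_or => /andP[/andP[] + _ _].
under eq_bigr do rewrite (flowD hPsi) subrK.
move=> /eta_prod_neq0 hx; apply: le_trans (hK ha) _; rewrite ler_wpM2l//.
exact: consistent_near.
Qed.

End consistent_states.

End accuracy.

(** * Mean square errors *)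

Lemma sqr_sum_le (R : realType) N (a : 'I_N -> R) :
  (\sum_(i < N) a i) ^+ 2 <= 2 ^+ N * \sum_(i < N) a i ^+ 2.
Proof.
elim: N a => [|N IH] a; first by rewrite !big_ord0 mulr0 expr0n.
rewrite !big_ord_recr /= (exprS 2 N) -mulrA.
set s := \sum_(i < N) a _; have := IH (fun i => a (widen_ord (leqnSn N) i)).
rewrite -/s; set t := \sum_(i < N) _ => hs.
apply: (@le_trans _ _ (2 * (s ^+ 2 + a ord_max ^+ 2))).
  rewrite -subr_ge0 (_ : _ - _ = (s - a ord_max) ^+ 2) ?sqr_ge0//; ring.
rewrite ler_wpM2l// mulrDr lerD// ler_peMl ?sqr_ge0// -[leLHS](expr1n R N).
by rewrite lerXn2r ?nnegrE// ler1n.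
Qed.

Section least_squares.
Context {R : realType} {d dobs : nat}.
Variables (Psi : R -> 'rV[R]_d -> 'rV[R]_d) (hPsi : is_flow lorenz96 Psi).
Variables (r h : R) (k : nat).
Let H : 'rV[R]_d -> 'rV[R]_dobs := obs.

(** The cost of an initial point, as a sum of absolute rather than squared residuals:
    it is then directly comparable with obs_gap. *)
Definition misfit (v : 'rV[R]_d) (y : k.+1.-tuple 'rV[R]_dobs) : R :=
  \sum_(i < k.+1) norm1 (tnth y i - H (Psi (i%:R * h) v)).

Lemma measurable_misfit v : measurable_fun setT (misfit v).
Proof.
apply: measurable_sum => i; apply: measurable_sum => l.
apply: measurableT_comp; first exact: normr_measurable.
rewrite (_ : (fun _ => _) = fun y : k.+1.-tuple 'rV[R]_dobs =>
  tnth y i ord0 l - H (Psi (i%:R * h) v) ord0 l); last first.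
  by apply/funext => y; rewrite !mxE.
apply: measurable_funB; last exact: measurable_cst.
exact: (measurableT_comp (measurable_coordR l) (measurable_tnth i)).
Qed.

(** Estimator of the state at time t: candidate initial points are ranked by their
    misfit, and their images at time t are followed. Since only countably many images
    are involved, the estimator is a measurable function of the data. *)
Definition state_estimator (t : R) : k.+1.-tuple 'rV[R]_dobs -> 'rV[R]_d :=
  estimator (fun n => misfit (rational_point r n))
            (fun n => Psi t (rational_point r n)).

Lemma measurable_state_estimator t : measurable_fun setT (state_estimator t).
Proof. by apply: measurable_estimator => n; exact: measurable_misfit. Qed.

Lemma measurable_observations disp (Omega : measurableType disp)
    (Z : nat -> Omega -> 'rV[R]_dobs) u : (forall i, measurable_fun setT (Z i)) ->
  measurable_fun setT (fun w => observations Psi h u k (Z ^~ w)).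
Proof.
move=> mZ; apply/measurable_fun_tnthP => i.
apply: (@measurable_fun_coord _ (measurableTypeR R)) => l.
rewrite (_ : (fun _ => _) = fun w => obs (Psi (i%:R * h) u) ord0 l + Z i w ord0 l).
  apply: measurable_funD; first exact: measurable_cst.
  exact: (measurableT_comp (measurable_coordR l) (mZ i)).
by apply/funext => w /=; rewrite tnth_mktuple mxE.
Qed.

(** The misfit of the true initial point is the total size S of the errors. Since
    candidates are dense, the best ones eventually have a misfit at most S + g for
    any g > 0, hence an obs_gap to u of at most 2 S + g. *)
Lemma state_estimator_error (u : 'rV[R]_d) (C : R) (t : R) :
  0 <= h -> 0 <= t -> norm2 u < r -> 0 <= C ->
  (forall v, Ball r v -> norm1 (v - u) <= C * obs_gap (dobs := dobs) Psi h k v u) ->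
  exists2 B : R, 0 <= B & forall z : nat -> 'rV[R]_dobs,
    norm1 (state_estimator t (observations Psi h u k z) - Psi t u) <=
      B * \sum_(i < k.+1) norm1 (z i).
Proof.
move=> h0 t0 ur C0 hC; have r0 : 0 <= r by rewrite (le_trans (norm2_ge0 u)) ?ltW.
have hu : Ball r u by exact: ltW.
have [K K0 hK] := flow_lipschitz hPsi r t.
have [L L0 hL] := flow_lipschitz hPsi r (k%:R * h).
exists (d%:R * (K * (C * 2))) => [|z]; first by rewrite !mulr_ge0.
set y := observations Psi h u k z; set S := \sum_(i < k.+1) _.
rewrite -!mulrA; apply: estimator_approx => e e0.
(* how close a candidate must be to u for the final error to exceed the bound by at
   most e, once its distance has passed through all Lipschitz constants *)
have [delta delta0 hdelta] : exists2 delta : R, 0 < delta &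
    K * (C * (k.+1%:R * (dobs%:R * (L * delta)))) <= e.
  pose M := K * (C * (k.+1%:R * (dobs%:R * L))).
  have M0 : 0 <= M by rewrite !mulr_ge0.
  exists (e / (1 + M)); first by rewrite divr_gt0// ltr_wpDr.
  rewrite (_ : _ * _ = e * (M / (1 + M))); last by rewrite /M; ring.
  by rewrite ler_piMr ?(ltW e0)// ler_pdivrMr ?ltr_wpDr// mul1r lerDr.
have [n hn] := rational_point_dense ur delta0.
exists n => m nm; set b := best _ m y; pose v := @rational_point R d r.
have hv p : Ball r (v p) by exact: rational_point_Ball.
pose g := k.+1%:R * (dobs%:R * (L * delta)).
have yE (i : 'I_k.+1) : tnth y i = H (Psi (i%:R * h) u) + z i.
  by rewrite tnth_mktuple.
have cost_n : misfit (v n) y <= S + g.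
  rewrite /g mulr_natl -[X in _ *+ X]card_ord -[X in _ + X]sumr_const -big_split.
  apply: ler_sum => i _ /=.
  apply: le_trans (norm1_dist_triangle (H (Psi (i%:R * h) u)) _ _) _.
  rewrite yE addrAC subrr add0r lerD2l /H obsB.
  apply: le_trans (norm1_obs _) _; rewrite ler_wpM2l//.
  apply: le_trans (hL _ _ _ hu (hv n) _) _.
    by rewrite mulr_ge0//= ler_wpM2r// ler_nat -ltnS.
  by rewrite ler_wpM2l// norm1_distC.
have cost_b : misfit (v b) y <= S + g 
  by apply: le_trans cost_n; exact: (best_le (fun n => misfit (v n)) y nm).
have gap_b : obs_gap (dobs := dobs) Psi h k (v b) u <= 2 * S + g.
  apply: (@le_trans _ _ (misfit (v b) y + S)); last first.
    by rewrite mulr_natl mulr2n addrAC lerD2r.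
  rewrite -big_split; apply: ler_sum => i _ /=.
  apply: le_trans (norm1_dist_triangle (tnth y i) _ _) _.
  by rewrite norm1_distC lerD// yE addrAC subrr add0r.
apply: le_trans (hK _ _ _ (hv b) hu _) _; first by rewrite t0 lexx.
apply: (@le_trans _ _ (K * (C * (2 * S + g)))).
  by rewrite ler_wpM2l//; apply: le_trans (hC _ (hv b)) _; rewrite ler_wpM2l.
by rewrite !mulrDr lerD2l.
Qed.

End least_squares.

Section mean_square.
Context {R : realType} {d dobs : nat}.
Variables (Psi : R -> 'rV[R]_d -> 'rV[R]_d) (h : R) (k : nat) (u a : 'rV[R]_d).
Variables (U : k.+1.-tuple 'rV[R]_dobs -> 'rV[R]_d) (B : R).
Hypotheses (mU : measurable_fun setT U) (B0 : 0 <= B).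
Hypothesis hU : forall z : nat -> 'rV[R]_dobs,
  norm1 (U (observations Psi h u k z) - a) <= B * \sum_(i < k.+1) norm1 (z i).

Lemma measurable_sqr_norm2 disp (Omega : measurableType disp) n
    (X : Omega -> 'rV[R]_n) :
  measurable_fun setT X -> measurable_fun setT (fun w => norm2 (X w) ^+ 2).
Proof.
move=> mX; rewrite (_ : (fun _ => _) = (fun x : 'rV[R]_n => dotv x x) \o X).
  exact: measurableT_comp (@measurable_dotvv R n) mX.
by apply/funext => w; rewrite sqr_norm2.
Qed.

(** A deterministic bound that is linear in the sizes of the errors is squared and
    integrated; the constant 2^(k+1) is the crude one of sqr_sum_le. *)
Lemma mean_square_le disp (Omega : measurableType disp) (P : probability Omega R)
    (Z : nat -> Omega -> 'rV[R]_dobs) (sigma : R) :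
  (forall i, measurable_fun setT (Z i)) ->
  (forall i, ('E_P[fun w => (norm2 (Z i w) ^+ 2)%R] = (sigma ^+ 2)%:E)%E) ->
  ('E_P[fun w => (norm2 (U (observations Psi h u k (Z ^~ w)) - a) ^+ 2)%R] <=
    (B ^+ 2 * (dobs%:R ^+ 2 * 2 ^+ k.+1) * k.+1%:R * sigma ^+ 2)%:E)%E.
Proof.
move=> mZ hsigma; set c := B ^+ 2 * _.
have c0 : 0 <= c by rewrite !mulr_ge0 ?exprn_ge0.
have pointwise w : norm2 (U (observations Psi h u k (Z ^~ w)) - a) ^+ 2 <=
    \sum_(i < k.+1) c * norm2 (Z i w) ^+ 2.
  apply: (@le_trans _ _ ((B * \sum_(i < k.+1) dobs%:R * norm2 (Z i w)) ^+ 2)).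
    rewrite ler_pXn2r ?nnegrE ?norm2_ge0//; last first.
      by rewrite mulr_ge0// sumr_ge0// => i _; rewrite mulr_ge0 ?norm2_ge0.
    apply: le_trans (norm2_le_norm1 _) _; apply: le_trans (hU _) _.
    by rewrite ler_wpM2l//; apply: ler_sum => i _; exact: norm1_le_norm2.
  rewrite -mulr_sumr -mulr_sumr !exprMn /c -!mulrA !ler_wpM2l ?exprn_ge0//.
  exact: sqr_sum_le.
rewrite unlock.
apply: (@le_trans _ _ (\int[P]_w \sum_(i < k.+1) (c%:E * (norm2 (Z i w) ^+ 2)%:E))%E).
  apply: ge0_le_integral => //.
  - by move=> w _; rewrite lee_fin sqr_ge0.
  - apply/measurable_EFinP; apply: measurable_sqr_norm2.
    apply: (@measurable_fun_coord _ (measurableTypeR R)) => l.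
    rewrite (_ : (fun _ => _) = fun w =>
      U (observations Psi h u k (Z ^~ w)) ord0 l - a ord0 l).
      apply: measurable_funB; last exact: measurable_cst.
      apply: (measurableT_comp (measurable_coordR l)).
      by apply: (measurableT_comp mU); exact: measurable_observations.
    by apply/funext => w; rewrite !mxE.
  - apply: emeasurable_sum => i; apply: measurable_funeM.
    by apply/measurable_EFinP; exact: measurable_sqr_norm2.
  - move=> w _; rewrite (_ : (\sum_(i < k.+1) _)%E =
      (\sum_(i < k.+1) c * norm2 (Z i w) ^+ 2)%:E) ?lee_fin//.
    by rewrite -sumEFin; apply: eq_bigr => i _; rewrite EFinM.
have mZ2 (i : 'I_k.+1) : measurable_fun setT (fun w => (norm2 (Z i w) ^+ 2)%:E).
  by apply/measurable_EFinP; exact: measurable_sqr_norm2.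
rewrite ge0_integral_sum//=; last 2 first.
- by move=> i; exact: measurable_funeM.
- by move=> i w _; rewrite mule_ge0// lee_fin ?sqr_ge0.
rewrite (eq_bigr (fun=> (c * sigma ^+ 2)%:E)) => [|i _]; last first.
  rewrite ge0_integralZl//; last by move=> w _; rewrite lee_fin sqr_ge0.
  by have := hsigma i; rewrite unlock => ->; rewrite EFinM.
by rewrite sumEFin sumr_const card_ord lee_fin -[leLHS]mulr_natr mulrAC.
Qed.

End mean_square.

(** * The Lorenz '96 system with three observed coordinates *)

Theorem proposition4p3 (R : realType) (d dobs : nat)
    (hd : (3 <= d)%N) (hdobs : (3 <= dobs)%N)
    (r : R) (hr : @trapping_radius R d r)
    (Psi : R -> 'rV[R]_d -> 'rV[R]_d) (hPsi : is_flow lorenz96 Psi)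
    (j : nat) (hj : (d - 3 <= j)%N) :
  let H : 'rV[R]_d -> 'rV[R]_dobs := obs in
  let D : nat -> 'rV[R]_d -> 'rV[R]_d := time_derivative Psi in
  [/\
    {ae lebesgue_rV d, forall u, Ball r u ->
      [/\ norm2 u < r,
          forall v, Ball r v ->
            (forall i, (i <= j)%N -> H (D i u) = H (D i v)) <-> v = u
        & <<[seq gradient (fun w => H (D i w) ord0 l) u
               | i <- iota 0 j.+1, l <- enum 'I_dobs]>>%VS
          = fullv ]},

    {ae lebesgue_rV d, forall u, Ball r u ->
      exists2 h0 : R, 0 < h0 & forall h : R, 0 < h <= h0 ->
      forall k : nat, (j <= k)%N ->
      exists Csm Cfi : R,
      forall (eps : R), 0 < eps ->
      forall (disp : measure_display) (Omega : measurableType disp)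
        (P : probability Omega R) (Z : nat -> Omega -> 'rV[R]_dobs)
        (eta : 'rV[R]_dobs -> R) (q : 'rV[R]_d -> R),
      noise_model P Z eta -> bounded_noise P Z eta eps -> is_prior r q ->
      {ae P, forall w,
        let Y := observations Psi h u k (Z ^~ w) in
        (forall mu, is_smoother Psi r q eta h Y mu ->
           (diameter (density_support mu) <= (Csm * eps)%:E)%E) /\
        (forall mu, is_filter Psi r q eta h Y mu ->
           (diameter (density_support mu) <= (Cfi * eps)%:E)%E)}}

    & exists Usm Ufi : R -> forall k : nat,
        k.+1.-tuple 'rV[R]_dobs -> 'rV[R]_d,
      (forall h k, measurable_fun setT (Usm h k) /\
                   measurable_fun setT (Ufi h k)) /\
      {ae lebesgue_rV d, forall u, Ball r u ->
        exists2 h0 : R, 0 < h0 & forall h : R, 0 < h <= h0 ->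
        forall k : nat, (j <= k)%N ->
        exists Dsm Dfi : R,
        forall (disp : measure_display) (Omega : measurableType disp)
          (P : probability Omega R) (Z : nat -> Omega -> 'rV[R]_dobs)
          (eta : 'rV[R]_dobs -> R) (sigma : R),
        noise_model P Z eta ->
        (forall i, ('E_P[fun w => (norm2 (Z i w) ^+ 2)%R] = (sigma ^+ 2)%:E)%E) ->
        let Y w := observations Psi h u k (Z ^~ w) in
        ('E_P[fun w => (norm2 (Usm h k (Y w) - u) ^+ 2)%R]
           <= (Dsm * sigma ^+ 2)%:E)%E /\
        ('E_P[fun w => (norm2 (Ufi h k (Y w) - Psi (k%:R * h) u) ^+ 2)%R]
           <= (Dfi * sigma ^+ 2)%:E)%E} ].
Proof.
move=> H D.
have d0 : (0 < d)%N by apply: leq_trans hd.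
have generic := ae_generic r d0.
split.
- apply: filterS generic => u [ur u0] hu.
  have ult : norm2 u < r by rewrite lt_neqAle ur; exact: hu.
  split=> //.
  + by move=> v hv; exact: (initial_jet_injective hdobs hPsi hj u0 hv).
  + exact: (initial_gradients_span hdobs hPsi hj ult u0).
- apply: filterS generic => u [_ u0] hu.
  have [h0 h00 hh0] := obs_stability hdobs hPsi hj hu u0.
  exists h0 => // h hh k jk; have [C C0 hC] := hh0 h hh k jk.
  have h_ge0 : 0 <= h by have /andP[/ltW] := hh.
  have [K K0 hK] := flow_lipschitz hPsi r (k%:R * h).
  have hK' v : Ball r v ->
      norm1 (Psi (k%:R * h) v - Psi (k%:R * h) u) <= K * norm1 (v - u).
    by move=> hv; apply: hK => //; rewrite lexx mulr_ge0.
  exists (2 * (C * (k.+1%:R * (2 * dobs%:R)))),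
         (2 * (K * (C * (k.+1%:R * (2 * dobs%:R))))).
  move=> eps eps0 disp Omega P Z eta q _ [Zeps etaeps] _.
  apply: filterS (ae_foralln Zeps) => w hw; split=> mu hmu.
  + have := smoother_diameter C0 hC hw etaeps hmu.
    by rewrite !mulrA.
  + have := filter_diameter hPsi C0 K0 hC hK' hw etaeps hmu.
    by rewrite !mulrA.
- exists (fun h k => @state_estimator R d dobs Psi r h k 0),
         (fun h k => @state_estimator R d dobs Psi r h k (k%:R * h)).
  split; first by move=> h k; split; exact: measurable_state_estimator.
  apply: filterS generic => u [ur u0] hu.
  have ult : norm2 u < r by rewrite lt_neqAle ur; exact: hu.
  have [h0 h00 hh0] := obs_stability hdobs hPsi hj hu u0.
  exists h0 => // h hh k jk; have [C C0 hC] := hh0 h hh k jk.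
  have h_ge0 : 0 <= h by have /andP[/ltW] := hh.
  have t_ge0 : 0 <= k%:R * h by rewrite mulr_ge0.
  have [Bsm Bsm0 hsm] := state_estimator_error hPsi h_ge0 (lexx 0) ult C0 hC.
  have [Bfi Bfi0 hfi] := state_estimator_error hPsi h_ge0 t_ge0 ult C0 hC.
  rewrite flow0// in hsm.
  pose c := (dobs%:R ^+ 2 * 2 ^+ k.+1 : R).
  exists (Bsm ^+ 2 * c * k.+1%:R), (Bfi ^+ 2 * c * k.+1%:R).
  move=> disp Omega P Z eta sigma [mZ _ _ _] hsigma; split.
  + apply: (mean_square_le _ Bsm0 hsm mZ hsigma).
    exact: measurable_state_estimator.
  + apply: (mean_square_le _ Bfi0 hfi mZ hsigma).
    exact: measurable_state_estimator.
Qed.
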